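(* Let $\epsilon$ be the optimal value of the optimization problem: maximize $\epsilon$ over real $\epsilon,c$ subject to $1.5\left(1+\frac{\epsilon(2c-1+\epsilon)}{1-c-\epsilon}\right)\le 2c(1-\epsilon)$, $\epsilon\le (1-c)^2$, $\epsilon+c<1$, $\epsilon>0$, $c>0$ (numerically $\epsilon\approx 0.02005$). There is a polynomial-time algorithm that, given an integer $\Delta\ge 3$ and a finite simple graph $G$ of maximum degree at most $\Delta$, produces an induced matching $M$ in $G$ with $$|M| \geq \frac{\nu_s^*(G)}{(1-\epsilon)\Delta+\frac{1}{2}}.$$
   Context: A set $M$ of edges of a graph $G$ is an induced matching if no two edges of $M$ share a vertex or are joined by an edge of $G$. For a vertex $u$, $\delta_G(u)$ is the set of edges incident with $u$; for an edge $uv$, $\delta_G(uv)=\delta_G(u)\cup\delta_G(v)$. The fractional induced matching number $\nu_s^*(G)$ is the optimum value of the linear program: maximize $\sum_{e\in E(G)} x_e$ subject to $\sum_{f\in\delta_G(e)} x_f\le 1$ for every $e\in E(G)$ and $x_e\ge 0$ for every $e\in E(G)$. *)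

(* Defs.v *)
From HB Require Import structures.
From mathcomp Require Import all_boot all_order all_algebra.
From mathcomp Require Import classical_sets reals.

Set Implicit Arguments.
Unset Strict Implicit.
Unset Printing Implicit Defensive.

Import Order.TTheory GRing.Theory Num.Theory.

Record sgraph (T : finType) := SGraph {
  adj :> rel T;
  adj_sym : symmetric adj;
  adj_irr : irreflexive adj }.

Section Graphs.
Variables (T : finType) (G : sgraph T).

Definition degree (u : T) : nat := #|[set v | G u v]|.

Definition max_degree : nat := \max_(u : T) degree u.

Definition edges : {set {set T}} := [set [set u; v] | u in T, v in T & G u v].

Definition delta (u : T) : {set {set T}} := [set f in edges | u \in f].

Definition edge_delta (e : {set T}) : {set {set T}} := \bigcup_(u in e) delta u.

Definition induced_matching (M : {set {set T}}) : Prop :=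
  M \subset edges /\
  forall f g, f \in M -> g \in M -> f != g ->
    [disjoint f & g] /\ (forall u v, u \in f -> v \in g -> ~~ G u v).

Local Open Scope ring_scope.

Definition lp_feasible (R : realType) (x : {set T} -> R) : Prop :=
  (forall e, e \in edges -> \sum_(f in edge_delta e) x f <= 1) /\
  (forall e, e \in edges -> 0 <= x e).

Definition fractional_induced_matching_number (R : realType) : R :=
  sup [set \sum_(e in edges) x e | x in [set x | lp_feasible x]]%classic.

End Graphs.

Section Epsilon.
Local Open Scope ring_scope.

Definition eps_feasible (R : realType) (eps c : R) : Prop :=
  [/\ 3 / 2 * (1 + eps * (2 * c - 1 + eps) / (1 - c - eps))
        <= 2 * c * (1 - eps),
      eps <= (1 - c) ^+ 2,
      eps + c < 1,
      0 < eps
    & 0 < c].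

Definition eps_opt (R : realType) : R :=
  sup [set eps : R | exists c : R, eps_feasible eps c]%classic.

End Epsilon.

(* Model of computation: Jones's WHILE language (N. D. Jones, Computability
   and Complexity from a Programming Perspective), whose data are binary trees.
   Instead of Jones's unit costs, the evaluation of an expression is charged
   the total number of nodes of the values of all its subexpressions, so that
   no sharing of subtrees is taken for granted: copying, building and comparing
   trees is paid for in full.  With this charge, running times agree with those
   of Turing machines up to a polynomial in both directions. *)

Inductive tree := Leaf | Node of tree & tree.

Fixpoint tree_size (t : tree) : nat :=
  if t is Node l r then (tree_size l + tree_size r).+1 else 1.

Fixpoint tree_eq (t u : tree) : bool :=
  match t, u with
  | Leaf, Leaf => true
  | Node l r, Node l' r' => tree_eq l l' && tree_eq r r'
  | _, _ => false
  end.

Definition tree_of_bool (b : bool) : tree := if b then Node Leaf Leaf else Leaf.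

Inductive expr :=
  | EVar of nat
  | ELeaf
  | ENode of expr & expr
  | EHead of expr
  | ETail of expr
  | EEq of expr & expr.

Inductive com :=
  | Assign of nat & expr
  | Seq of com & com
  | If of expr & com & com
  | While of expr & com.

Definition store := nat -> tree.

Definition update (s : store) (x : nat) (t : tree) : store :=
  fun y => if y == x then t else s y.

Fixpoint eval (e : expr) (s : store) : tree :=
  match e with
  | EVar x => s x
  | ELeaf => Leaf
  | ENode e1 e2 => Node (eval e1 s) (eval e2 s)
  | EHead e1 => if eval e1 s is Node l _ then l else Leaf
  | ETail e1 => if eval e1 s is Node _ r then r else Leaf
  | EEq e1 e2 => tree_of_bool (tree_eq (eval e1 s) (eval e2 s))
  end.

Fixpoint cost (e : expr) (s : store) : nat :=
  tree_size (eval e s) +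
  match e with
  | EVar _ | ELeaf => 0
  | EHead e1 | ETail e1 => cost e1 s
  | ENode e1 e2 | EEq e1 e2 => cost e1 s + cost e2 s
  end.

Definition is_true_tree (t : tree) : bool := if t is Leaf then false else true.

(* [exec c s s' t]: started in [s], [c] halts in [s'] after time [t]. *)
Inductive exec : com -> store -> store -> nat -> Prop :=
  | ExecAssign x e s :
      exec (Assign x e) s (update s x (eval e s)) (cost e s)
  | ExecSeq c1 c2 s s1 s2 t1 t2 :
      exec c1 s s1 t1 -> exec c2 s1 s2 t2 ->
      exec (Seq c1 c2) s s2 (t1 + t2)
  | ExecIfTrue e c1 c2 s s' t :
      is_true_tree (eval e s) -> exec c1 s s' t ->
      exec (If e c1 c2) s s' (cost e s + t)
  | ExecIfFalse e c1 c2 s s' t :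
      ~~ is_true_tree (eval e s) -> exec c2 s s' t ->
      exec (If e c1 c2) s s' (cost e s + t)
  | ExecWhileTrue e c s s1 s2 t1 t2 :
      is_true_tree (eval e s) -> exec c s s1 t1 -> exec (While e c) s1 s2 t2 ->
      exec (While e c) s s2 (cost e s + t1 + t2)
  | ExecWhileFalse e c s :
      ~~ is_true_tree (eval e s) ->
      exec (While e c) s s (cost e s).

(* Input and output are passed in variable 0. *)
Definition computes (p : com) (input output : tree) (t : nat) : Prop :=
  exists2 s' : store,
    exec p (update (fun=> Leaf) 0 input) s' t & s' 0 = output.

Definition tree_of_seq (A : Type) (f : A -> tree) (s : seq A) : tree :=
  foldr (fun a t => Node (f a) t) Leaf s.

Definition tree_of_unary (k : nat) : tree := iter k (Node Leaf) Leaf.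

(* Least significant bit first. *)
Definition binary_digits (k : nat) : seq bool :=
  [seq odd (k %/ 2 ^ i) | i <- iota 0 (trunc_log 2 k).+1].

Definition adjacency_rows (n : nat) (G : sgraph 'I_n) : seq (seq bool) :=
  [seq [seq G u v | v <- enum 'I_n] | u <- enum 'I_n].

(* An instance is [Delta] in binary together with the adjacency matrix of the
   graph. *)
Definition tree_of_instance (Delta n : nat) (G : sgraph 'I_n) : tree :=
  Node (tree_of_seq tree_of_bool (binary_digits Delta))
       (tree_of_seq (tree_of_seq tree_of_bool) (adjacency_rows G)).

(* Vertices are output in unary, which is polynomial in the size of the
   adjacency matrix. *)
Definition tree_of_pairs (n : nat) (s : seq ('I_n * 'I_n)) : tree :=
  tree_of_seq
    (fun p : 'I_n * 'I_n => Node (tree_of_unary p.1) (tree_of_unary p.2)) s.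

Definition set_of_pairs (n : nat) (s : seq ('I_n * 'I_n)) : {set {set 'I_n}} :=
  [set [set p.1; p.2] | p in s].

(* Main.v *)
(** Let [A] be the 0-1 matrix, indexed by the edges, of "equal or sharing a
    vertex".  The linear program maximizes the mass [X] of [x >= 0] under
    [A x <= 1], and two edges conflict iff the entry of [A^2] is nonzero.

    Comparing [2 D(u) D(w)] with [(D(u) + D(w))^2 / 2], where [D] is the sum of
    [x] around a vertex, shows that the conflict form of [x] is at most
    [(|A x|^2 + |x|^2) / 2], hence at most [(|E| + X) / 2] for a feasible [x].
    By a Motzkin-Straus argument, greedily picking edges of least conflict
    degree in the multiset [x] produces an induced matching [M] with
    [X^2 <= |M| (|E| + X) / 2].  The linear program need not be solved:
    [|A x|^2 + |x|^2] is a convex quadratic form, and Frank-Wolfe steps that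
    each add one edge to a multiset minimize it well enough on the simplex
    after polynomially many steps, with unary arithmetic.

    If moreover no exchange of at most one edge of [M] for two edges (or of
    none for one) is possible, then the edges in conflict with a single
    [e \in M] form a strong clique, of size at most [11/7 Delta^2], while [e]
    conflicts with at most [2 Delta^2] edges; thus
    [14 |E| <= 25 Delta^2 |M|].  Eliminating [|E|] from the two bounds gives
    [X <= (19/20 Delta + 1/2) |M|], and the constraints that define [epsilon]
    force [c >= 3/4] and then [epsilon <= 1/20]. *)

Require Import Defs.
From mathcomp Require Import all_boot all_order all_algebra reals.
From mathcomp Require Import zify ring lra.
From mathcomp Require boolp classical_sets.

Set Implicit Arguments.
Unset Strict Implicit.
Unset Printing Implicit Defensive.

Import Order.TTheory GRing.Theory Num.Theory.

(** * Polynomial-time programs *)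

(** Eliminating [|E|] gives, up to terms linear in [X], [X^2 <= 25/28 Delta^2 |M|^2], and the root
    of [25/28] is about 0.945, below [19/20]. The summand [1/2] absorbs the linear terms, among them
    the error [X / 2] that the Frank-Wolfe phase is allowed to leave. Two obstacles shape the formal
    proof. Copying a tree is charged in full, so every construct has to control the size of its
    value along with its time; [ptime] records both, relative to a list of input values, and is
    closed under substitution and under folds whose accumulator grows additively. Moreover, the
    machine works on pairs of numbers, whereas the analysis needs a finite type of vertices; the
    algorithm is therefore written over an arbitrary type with a relation [touch], and it commutes
    with injective relabellings. *)

Section Computability.
Local Open Scope nat_scope.

Section PolynomialBounds.
Variable Gam : Type.
Implicit Types (es : seq (Gam -> tree)) (b : Gam -> nat).

(** The summand 2 keeps the base of all bounds at least 2, so that constants and sums of bounds are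
    absorbed by a larger exponent. *)
Definition env_size es (g : Gam) : nat := (\sum_(e <- es) tree_size (e g)).+2.

Definition poly_bounded es b := exists d, forall g, b g <= env_size es g ^ d.

Lemma env_size_gt1 es g : 1 < env_size es g. Proof. by []. Qed.
Hint Resolve env_size_gt1 : core.

Lemma pb_le es b b' :
  (forall g, b g <= b' g) -> poly_bounded es b' -> poly_bounded es b.
Proof. by move=> le_bb' [d Hd]; exists d => g; apply: leq_trans (Hd g). Qed.

Lemma pb_const es n : poly_bounded es (fun=> n).
Proof.
exists n => g; apply: leq_trans (ltnW (ltn_expl n (env_size_gt1 es g))) _.
by rewrite leq_exp2l.
Qed.

Lemma pb_mul es b b' : poly_bounded es b -> poly_bounded es b' ->
  poly_bounded es (fun g => b g * b' g).
Proof.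
by move=> [d Hd] [d' Hd']; exists (d + d') => g; rewrite expnD leq_mul.
Qed.

Lemma pb_add es b b' : poly_bounded es b -> poly_bounded es b' ->
  poly_bounded es (fun g => b g + b' g).
Proof.
move=> [d Hd] [d' Hd']; exists (maxn d d').+1 => g.
rewrite expnS; apply: (@leq_trans (2 * env_size es g ^ maxn d d')); last first.
  by rewrite leq_mul2r env_size_gt1 orbT.
rewrite mul2n -addnn leq_add //.
  by apply: leq_trans (Hd g) _; rewrite leq_exp2l // leq_maxl.
by apply: leq_trans (Hd' g) _; rewrite leq_exp2l // leq_maxr.
Qed.

Lemma pb_exp es b n : poly_bounded es b -> poly_bounded es (fun g => b g ^ n).
Proof.
by move=> [d Hd]; exists (d * n) => g; rewrite expnM; case: n => // n; rewrite leq_exp2r.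
Qed.

Lemma pb_env_size es : poly_bounded es (env_size es).
Proof. by exists 1 => g; rewrite expn1. Qed.

End PolynomialBounds.

Section Programs.

(* The program [c loc k] finds the values of [es] in the registers [loc], all
   below [k], leaves its result in register [k] and does not change the
   registers below [k], so that programs can be nested without renaming. *)
Definition implements (Gam : Type) (es : seq (Gam -> tree)) (f : Gam -> tree)
    (c : seq nat -> nat -> com) (b : Gam -> nat) :=
  forall g loc k s, map s loc = [seq e g | e <- es] -> all (fun i => i < k) loc ->
  exists s' t, [/\ exec (c loc k) s s' t, s' k = f g,
    forall j, j < k -> s' j = s j & t <= b g].

(** The size of the value is bounded along with the time, since the value is the input of whatever
    program comes next. The list [es] acts as a context of available inputs, and all bounds are
    polynomial in their sizes. *)
Definition ptime (Gam : Type) (es : seq (Gam -> tree)) (f : Gam -> tree) :=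
  exists c b, [/\ implements es f c b, poly_bounded es b
    & poly_bounded es (fun g => tree_size (f g))].

Variables (Gam : Type) (es : seq (Gam -> tree)).

Lemma map_agree (s s' : store) k loc : all (fun i => i < k) loc ->
  (forall j, j < k -> s' j = s j) -> map s' loc = map s loc.
Proof.
move=> /allP Hk H; apply/eq_in_map => i /Hk; exact: H.
Qed.

Lemma all_ltW k k' loc : k <= k' -> all (fun i => i < k) loc ->
  all (fun i => i < k') loc.
Proof. by move=> H; apply: sub_all => i Hi; apply: leq_trans H. Qed.

Lemma pt_ext f f' : f =1 f' -> ptime es f -> ptime es f'.
Proof.
move=> eff' [c [b [Hc Hb Hf]]]; exists c, b; split=> //.
  move=> g loc k s Hs Hl; have [s' [t [H1 H2 H3 H4]]] := Hc g loc k s Hs Hl.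
  by exists s', t; split=> //; rewrite H2.
by apply: pb_le Hf => g; rewrite eff'.
Qed.

Lemma pt_expr1 (F : tree -> tree) (x : expr -> expr) f :
  (forall e s, eval (x e) s = F (eval e s)) ->
  (forall e s, cost (x e) s <= cost e s + tree_size (eval (x e) s)) ->
  (forall t, tree_size (F t) <= (tree_size t).+2) ->
  ptime es f -> ptime es (fun g => F (f g)).
Proof.
move=> HF Hcost Hsz [c [b [Hc Hb Hf]]].
have HFf : poly_bounded es (fun g => tree_size (F (f g))).
  apply: (@pb_le _ _ _ (fun g => tree_size (f g) + 2)); last first.
    by apply: pb_add => //; apply: pb_const.
  by move=> g; rewrite addn2.
exists (fun loc k => Seq (c loc k) (Assign k (x (EVar k)))).
exists (fun g => b g + (tree_size (f g) + tree_size (F (f g)))); split=> //.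
  move=> g loc k s Hs Hl; have [s' [t [H1 H2 H3 H4]]] := Hc g loc k s Hs Hl.
  exists (update s' k (eval (x (EVar k)) s')), (t + cost (x (EVar k)) s').
  split.
  - by apply: ExecSeq H1 _; apply: ExecAssign.
  - by rewrite /update eqxx HF /= H2.
  - by move=> j Hj; rewrite /update ltn_eqF // H3.
  apply: leq_add => //; apply: leq_trans (Hcost _ _) _.
  by rewrite HF /= H2 addn0.
by do 2?apply: pb_add => //.
Qed.

Lemma pt_leaf : ptime es (fun=> Leaf).
Proof.
exists (fun loc k => Assign k ELeaf), (fun=> 1); split; try exact: pb_const.
move=> g loc k s Hs Hl; exists (update s k Leaf), 1; split=> //.
- exact: (ExecAssign k ELeaf s).
- by rewrite /update eqxx.
by move=> j Hj; rewrite /update ltn_eqF.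
Qed.

Lemma pt_var_nth i : i < size es -> ptime es (nth (fun=> Leaf) es i).
Proof.
move=> Hi.
have Hsz : poly_bounded es (fun g => tree_size (nth (fun=> Leaf) es i g)).
  exists 1 => g; rewrite expn1 /env_size.
  apply: leqW; apply: leqW.
  by rewrite (big_nth (fun=> Leaf)) big_mkord (bigD1 (Ordinal Hi)) //= leq_addr.
exists (fun loc k => Assign k (EVar (nth 0 loc i))).
exists (fun g => tree_size (nth (fun=> Leaf) es i g)); split=> //.
move=> g loc k s Hs Hl.
have szl : size loc = size es by rewrite -(size_map s loc) Hs size_map.
have E : s (nth 0 loc i) = nth (fun=> Leaf) es i g.
  by rewrite -(nth_map _ Leaf) ?szl // Hs (nth_map (fun=> Leaf)).
exists (update s k (s (nth 0 loc i))), (cost (EVar (nth 0 loc i)) s).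
split=> //.
- exact: (ExecAssign k (EVar _) s).
- by rewrite /update eqxx E.
- by move=> j Hj; rewrite /update ltn_eqF.
by rewrite /= addn0 E.
Qed.

Lemma pt_expr2 (F : tree -> tree -> tree) (x : expr -> expr -> expr) f h :
  (forall e e' s, eval (x e e') s = F (eval e s) (eval e' s)) ->
  (forall e e' s, cost (x e e') s
     <= cost e s + cost e' s + tree_size (eval (x e e') s)) ->
  (forall t u, tree_size (F t u) <= (tree_size t + tree_size u).+3) ->
  ptime es f -> ptime es h -> ptime es (fun g => F (f g) (h g)).
Proof.
move=> HF Hcost Hsz [c [b [Hc Hb Hf]]] [c' [b' [Hc' Hb' Hh]]].
have HFf : poly_bounded es (fun g => tree_size (F (f g) (h g))).
  apply: (@pb_le _ _ _ (fun g => tree_size (f g) + tree_size (h g) + 3)); last first.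
    by do 2?apply: pb_add => //; apply: pb_const.
  by move=> g; rewrite addn3.
exists (fun loc k => Seq (Seq (c loc k) (c' loc k.+1))
                         (Assign k (x (EVar k) (EVar k.+1)))).
exists (fun g => b g + b' g +
  (tree_size (f g) + tree_size (h g) + tree_size (F (f g) (h g)))).
split=> //; last by do 4?apply: pb_add => //.
move=> g loc k s Hs Hl.
have [s' [t [H1 H2 H3 H4]]] := Hc g loc k s Hs Hl.
have [||s2 [t2 [K1 K2 K3 K4]]] := Hc' g loc k.+1 s'.
- by rewrite (map_agree Hl H3).
- exact: all_ltW Hl.
exists (update s2 k (eval (x (EVar k) (EVar k.+1)) s2)).
exists (t + t2 + cost (x (EVar k) (EVar k.+1)) s2); split.
- by apply: ExecSeq; [apply: ExecSeq H1 K1 | apply: ExecAssign].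
- by rewrite /update eqxx HF /= K2 K3 // H2.
- by move=> j Hj; rewrite /update ltn_eqF // K3 ?H3 // ltnW.
apply: leq_add; first exact: leq_add.
apply: leq_trans (Hcost _ _ _) _.
by rewrite HF /= K2 K3 // H2 !addn0.
Qed.

Lemma pt_node f h : ptime es f -> ptime es h ->
  ptime es (fun g => Node (f g) (h g)).
Proof.
apply: (@pt_expr2 Node ENode) => //= [e e' s|t u]; first by rewrite addnC.
by do 2!apply: leqW.
Qed.

Lemma pt_head f : ptime es f ->
  ptime es (fun g => if f g is Node l _ then l else Leaf).
Proof.
apply: (@pt_expr1 (fun t => if t is Node l _ then l else Leaf) EHead) => //=.
  by move=> e s; rewrite addnC.
by case=> //= l r; lia.
Qed.

Lemma pt_tail f : ptime es f ->
  ptime es (fun g => if f g is Node _ r then r else Leaf).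
Proof.
apply: (@pt_expr1 (fun t => if t is Node _ r then r else Leaf) ETail) => //=.
  by move=> e s; rewrite addnC.
by case=> //= l r; lia.
Qed.

Lemma pt_tree_eq f h : ptime es f -> ptime es h ->
  ptime es (fun g => tree_of_bool (tree_eq (f g) (h g))).
Proof.
apply: (@pt_expr2 (fun t u => tree_of_bool (tree_eq t u)) EEq) => //=.
  by move=> e e' s; rewrite addnC.
by move=> t u; case: (tree_eq t u) => /=; lia.
Qed.

Lemma pt_if (q : Gam -> bool) f h :
  ptime es (fun g => tree_of_bool (q g)) -> ptime es f -> ptime es h ->
  ptime es (fun g => if q g then f g else h g).
Proof.
move=> [cq [bq [Hcq Hbq _]]] [c [b [Hc Hb Hf]]] [c' [b' [Hc' Hb' Hh]]].
exists (fun loc k => Seq (cq loc k) (If (EVar k) (c loc k) (c' loc k))).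
exists (fun g => bq g + (3 + (b g + b' g))); split.
- move=> g loc k s Hs Hl.
  have [s' [t [H1 H2 H3 H4]]] := Hcq g loc k s Hs Hl.
  have Hs' : map s' loc = [seq e g | e <- es] by rewrite (map_agree Hl H3).
  have Hk : cost (EVar k) s' <= 3 by rewrite /= H2; case: (q g).
  case: ifP => Hq.
    have [s2 [t2 [K1 K2 K3 K4]]] := Hc g loc k s' Hs' Hl.
    exists s2, (t + (cost (EVar k) s' + t2)); split=> //.
    + by apply: ExecSeq H1 _; apply: ExecIfTrue => //=; rewrite H2 Hq.
    + by move=> j Hj; rewrite K3 // H3.
    by rewrite leq_add // leq_add // (leq_trans K4) // leq_addr.
  have [s2 [t2 [K1 K2 K3 K4]]] := Hc' g loc k s' Hs' Hl.
  exists s2, (t + (cost (EVar k) s' + t2)); split=> //.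
  + by apply: ExecSeq H1 _; apply: ExecIfFalse => //=; rewrite H2 Hq.
  + by move=> j Hj; rewrite K3 // H3.
  by rewrite leq_add // leq_add // (leq_trans K4) // leq_addl.
- by do 3?apply: pb_add => //; apply: pb_const.
apply: (pb_le _ (pb_add Hf Hh)) => g.
by case: ifP => _; rewrite ?leq_addr ?leq_addl.
Qed.

End Programs.

Fixpoint ptimes (Gam : Type) (es : seq (Gam -> tree)) (fs : seq (Gam -> tree)) : Prop :=
  if fs is f :: fs' then ptime es f /\ ptimes es fs' else True.

Section Substitution.
Variables (Gam Del : Type) (es : seq (Gam -> tree)) (ds : seq (Del -> tree)).

(** The values go to consecutive registers: the programs for the remaining ones start at [k.+1] and
    cannot overwrite register [k]. *)
Lemma ptimes_implements (fs : seq (Gam -> tree)) : ptimes es fs ->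
  exists c b, poly_bounded es b /\
  (forall g loc k s, map s loc = [seq e g | e <- es] -> all (fun i => i < k) loc ->
   exists s' t, [/\ exec (c loc k) s s' t,
     map s' (iota k (size fs)) = [seq f g | f <- fs],
     forall j, j < k -> s' j = s j & t <= b g]).
Proof.
elim: fs => [_|f fs IH [[c [b [Hc Hb Hf]]] /IH [c' [b' [Hb' Hc']]]]].
  (* The language has no skip; an assignment to the scratch register [k] takes its place. *)
  exists (fun loc k => Assign k ELeaf), (fun=> 1); split; first exact: pb_const.
  move=> g loc k s Hs Hl; exists (update s k Leaf), 1; split=> //.
    exact: (ExecAssign k ELeaf s).
  by move=> j Hj; rewrite /update ltn_eqF.
exists (fun loc k => Seq (c loc k) (c' loc k.+1)), (fun g => b g + b' g).
split; first exact: pb_add.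
move=> g loc k s Hs Hl.
have [s' [t [H1 H2 H3 H4]]] := Hc g loc k s Hs Hl.
have [||s2 [t2 [K1 K2 K3 K4]]] := Hc' g loc k.+1 s'.
- by rewrite (map_agree Hl H3).
- exact: all_ltW Hl.
exists s2, (t + t2); split; last exact: leq_add.
- exact: ExecSeq H1 K1.
- by rewrite /= K2 K3 // H2.
by move=> j Hj; rewrite K3 ?H3 // ltnW.
Qed.

Lemma ptimes_env_size (fs : seq (Gam -> tree)) : ptimes es fs ->
  poly_bounded es (env_size fs).
Proof.
elim: fs => [_|f fs IH [[c [b [_ _ Hf]]] /IH Hfs]].
  by apply: (pb_le _ (pb_const es 2)) => g; rewrite /env_size big_nil.
apply: (pb_le _ (pb_add Hf Hfs)) => g.
by rewrite /env_size big_cons !addnS.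
Qed.

Lemma pb_subst (phi : Gam -> Del) (b : Del -> nat) :
  ptimes es [seq d \o phi | d <- ds] ->
  poly_bounded ds b -> poly_bounded es (b \o phi).
Proof.
move=> /ptimes_env_size H [d Hd]; apply: (pb_le _ (pb_exp d H)) => g /=.
by apply: leq_trans (Hd _) _; rewrite /env_size big_map.
Qed.

(** The values of [ds] fill the registers from [k] on, the program for [f] runs above them at
    [k + n], and its result is copied down to [k]. The bounds compose because the sizes of these
    values are polynomially bounded. *)
Lemma pt_subst (phi : Gam -> Del) (f : Del -> tree) :
  ptimes es [seq d \o phi | d <- ds] -> ptime ds f ->
  ptime es (fun g => f (phi g)).
Proof.
move=> Hds [c' [b' [Hc' Hb' Hf]]].
have [c [b [Hb Hc]]] := ptimes_implements Hds.
have Hsz := pb_subst Hds Hf.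
set n := size ds.
exists (fun loc k => Seq (Seq (c loc k) (c' (iota k n) (k + n)))
                         (Assign k (EVar (k + n)))).
exists (fun g => b g + b' (phi g) + tree_size (f (phi g))); split=> //; last first.
  by do 2?apply: pb_add => //; apply: (pb_subst Hds).
move=> g loc k s Hs Hl.
have [s' [t [H1 H2 H3 H4]]] := Hc g loc k s Hs Hl.
rewrite size_map -/n in H2.
have [||s2 [t2 [K1 K2 K3 K4]]] := Hc' (phi g) (iota k n) (k + n) s'.
- by rewrite H2 -map_comp.
- by apply/allP => i; rewrite mem_iota => /andP[].
exists (update s2 k (s2 (k + n))), (t + t2 + cost (EVar (k + n)) s2); split.
- by apply: ExecSeq; [apply: ExecSeq H1 K1 | apply: (ExecAssign k (EVar _))].
- by rewrite /update eqxx.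
- by move=> j Hj; rewrite /update ltn_eqF // K3 ?H3 // ltn_addr.
by rewrite leq_add // ?leq_add //= K2 addn0.
Qed.

End Substitution.

Lemma ptimes_drop (Gam : Type) (es : seq (Gam -> tree)) i : ptimes es (drop i es).
Proof.
move Em: (size es - i) => m; elim: m i Em => [|m IH] i Em.
  by rewrite drop_oversize //; rewrite -subn_eq0 Em.
rewrite (drop_nth (fun=> Leaf)); last by rewrite -subn_gt0 Em.
split; first by apply: pt_var_nth; rewrite -subn_gt0 Em.
by apply: IH; rewrite subnS Em.
Qed.

Lemma ptimes_catr (Gam : Type) (xs es : seq (Gam -> tree)) : ptimes (xs ++ es) es.
Proof. by rewrite -{2}(drop_size_cat es (erefl (size xs))); apply: ptimes_drop. Qed.

(** The context inside the body of a map or a filter: the bound element comes first, like a variable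
    of de Bruijn index 0. *)
Definition elem_env (Gam C : Type) (eC : C -> tree) (es : seq (Gam -> tree)) :
    seq (Gam * C -> tree) :=
  (fun p => eC p.2) :: [seq (fun p => e p.1) | e <- es].

Lemma env_size_elem (Gam C : Type) (eC : C -> tree) (es : seq (Gam -> tree)) g c :
  env_size (elem_env eC es) (g, c) = env_size es g + tree_size (eC c).
Proof. by rewrite /env_size big_cons big_map /= addnC. Qed.

Section Fold.
Variables (Gam C B : Type) (es : seq (Gam -> tree)).
Variables (eC : C -> tree) (eB : B -> tree).

Definition fold_env : seq (Gam * (C * B) -> tree) :=
  (fun p => eC p.2.1) :: (fun p => eB p.2.2) :: [seq (fun p => e p.1) | e <- es].

(* Additive growth keeps the accumulator polynomially bounded along a whole
   fold; multiplicative growth would not. *)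
Definition additive_growth (step : Gam -> B -> C -> B) :=
  exists2 G : Gam * C -> nat, poly_bounded (elem_env eC es) G &
    forall g b c, tree_size (eB (step g b c)) <= tree_size (eB b) + G (g, c).

Lemma size_le_tree_of_seq (l : seq C) : size l < tree_size (tree_of_seq eC l).
Proof.
elim: l => //= c l IH; rewrite ltnS; apply: leq_trans IH _; exact: leq_addl.
Qed.

(** Register [k] holds the rest of the list, [k.+1] the accumulator and [k.+2] the current element;
    the step runs from [k.+3] on. Each of fewer than [L] steps adds at most [Gr], so [U] bounds
    every accumulator that occurs; hence [V] bounds the time of a step and [W] that of a round of
    the loop. *)
Lemma pt_fold (l : Gam -> seq C) (i : Gam -> B) (step : Gam -> B -> C -> B) :
  ptime es (fun g => tree_of_seq eC (l g)) ->
  ptime es (fun g => eB (i g)) ->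
  ptime fold_env (fun p => eB (step p.1 p.2.2 p.2.1)) ->
  additive_growth step ->
  ptime es (fun g => eB (foldl (step g) (i g) (l g))).
Proof.
move=> [cl [bl [Hcl Hbl Hl]]] [ci [bi [Hci Hbi Hi]]] [cs [bs [Hcs [ds Hbs] _]]].
move=> [G [dg HG] Hgr'].
have Hgr g b c := leq_trans (Hgr' g b c)
  (leq_add (leqnn _) (leq_trans (HG (g, c)) (eq_leq (congr1 (fun n => n ^ dg) (env_size_elem eC es g c))))).
pose L g := tree_size (tree_of_seq eC (l g)).
pose Gr g := (env_size es g + L g) ^ dg.
pose U g := tree_size (eB (i g)) + L g * Gr g.
pose V g := (env_size es g + L g + U g) ^ ds.
pose W g := L g + (L g + L g + (V g + (U g + (L g + L g)))) + L g.
have HL : poly_bounded es L by [].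
have HGr : poly_bounded es Gr.
  by apply: pb_exp; apply: pb_add => //; apply: pb_env_size.
have HU : poly_bounded es U by apply: pb_add => //; apply: pb_mul.
have HV : poly_bounded es V.
  by apply: pb_exp; apply: pb_add => //; apply: pb_add => //; apply: pb_env_size.
have HW : poly_bounded es W by do ![apply: pb_add => //].
pose body loc k := Seq (Assign k.+2 (EHead (EVar k)))
   (Seq (cs (k.+2 :: k.+1 :: loc) k.+3)
   (Seq (Assign k.+1 (EVar k.+3)) (Assign k (ETail (EVar k))))).
(* Invariant: the accumulator, together with all the growth that the remaining list can still cause,
   fits into [U]. *)
have loop g loc k : all (fun i => i < k) loc -> forall m s b,
    tree_size (tree_of_seq eC m) <= L g ->
    tree_size (eB b) + size m * Gr g <= U g ->
    map s loc = [seq e g | e <- es] -> s k = tree_of_seq eC m -> s k.+1 = eB b ->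
    exists s' t, [/\ exec (While (EVar k) (body loc k)) s s' t,
      s' k.+1 = eB (foldl (step g) b m), forall j, j < k -> s' j = s j,
      t <= (size m).+1 * W g & tree_size (s' k.+1) <= U g].
  move=> Hloc; elim=> [|c m IH] s b HmL HbU Hs Hk Hk1.
    exists s, (cost (EVar k) s); split=> //.
    - by apply: ExecWhileFalse; rewrite /= Hk.
    - by rewrite /= Hk mul1n; apply: leq_trans (leq_addr _ _); apply: leq_trans HmL (leq_addr _ _).
    by rewrite Hk1; move: HbU; rewrite mul0n addn0.
  rewrite /= in HmL HbU.
  have Hc : tree_size (eC c) <= L g by lia.
  have Hm : tree_size (tree_of_seq eC m) <= L g by lia.
  have Hb : tree_size (eB b) <= U g by apply: leq_trans HbU; apply: leq_addr.
  set s1 := update s k.+2 (eC c).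
  have Hs1 : map s1 loc = map s loc.
    by apply: (map_agree Hloc) => j Hj; rewrite /s1 /update ltn_eqF // !leqW.
  have [||s2 [t2 [K1 K2 K3 K4]]] :=
    Hcs (g, (c, b)) (k.+2 :: k.+1 :: loc) k.+3 s1.
  - rewrite /= -map_comp /= Hs1 Hs /s1 /update eqxx Hk1.
    by rewrite (ltn_eqF (ltnSn k.+1)).
  - by rewrite /= !ltnS leqnn leqnSn /=; apply: all_ltW Hloc; rewrite !leqW.
  set b' := step g b c in K2 *.
  set s3 := update s2 k.+1 (eB b').
  set s4 := update s3 k (tree_of_seq eC m).
  have Hstep : tree_size (eB b') <= tree_size (eB b) + Gr g.
    apply: leq_trans (Hgr g b c) _; rewrite leq_add2l /Gr.
    by case: (dg) => // d; rewrite leq_exp2r // leq_add2l.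
  have HbU' : tree_size (eB b') + size m * Gr g <= U g.
    apply: leq_trans HbU; rewrite mulSn addnA leq_add2r; exact: Hstep.
  have s2k : s2 k = s k.
    by rewrite K3 ?ltnS ?leqW // /s1 /update ltn_eqF ?ltnS ?leqnSn.
  have [|||s' [t [J1 J2 J3 J4 J5]]] := IH s4 b' Hm HbU'.
  - rewrite -Hs; apply: (map_agree Hloc) => j Hj.
    rewrite /s4 /s3 /update !ltn_eqF ?ltnS ?(ltnW Hj) //.
    rewrite K3 /s1 /update ?ltn_eqF ?ltnS //; first by rewrite !leqW // ltnW.
    by rewrite !leqW // ltnW.
  - by rewrite /s4 /update eqxx.
  - by rewrite /s4 /s3 /update gtn_eqF // eqxx.
  have Hvs : t2 <= V g.
    apply: leq_trans K4 _; apply: leq_trans (Hbs _) _.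
    rewrite /V; case: (ds) => // d; rewrite leq_exp2r //.
    rewrite /env_size /= !big_cons /= big_map /=.
    by set S := \sum_(e <- es) _; move: Hc Hb; clear; lia.
  exists s'; eexists; split; first last.
  - exact: J5.
  - instantiate (1 := cost (EVar k) s +
      (cost (EHead (EVar k)) s + (t2 + (cost (EVar k.+3) s2 + cost (ETail (EVar k)) s3))) + t).
    rewrite mulSn leq_add // /W.
    have s3k : s3 k = s k by rewrite /s3 /update ltn_eqF.
    have Hb' : tree_size (eB b') <= U g by apply: leq_trans HbU'; apply: leq_addr.
    by rewrite /= K2 s3k Hk /= !addn0; move: HmL Hc Hm Hb' Hvs; clear; lia.
  - move=> j Hj; rewrite J3 //.
    rewrite /s4 /s3 /update !ltn_eqF ?ltnS ?(ltnW Hj) //.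
    rewrite K3 /s1 /update ?ltn_eqF ?ltnS //; first by rewrite !leqW // ltnW.
    by rewrite !leqW // ltnW.
  - exact: J2.
  apply: (ExecWhileTrue _ _ J1); first by rewrite /= Hk.
  apply: ExecSeq; first exact: ExecAssign.
  rewrite /= Hk /= -/s1; apply: ExecSeq; first exact: K1.
  have -> : s4 = update s3 k (eval (ETail (EVar k)) s3).
    by rewrite /= /s4 /s3 /update ltn_eqF // s2k Hk.
  apply: ExecSeq; last exact: ExecAssign.
  have -> : s3 = update s2 k.+1 (eval (EVar k.+3) s2) by rewrite /s3 /= K2.
  exact: ExecAssign.
exists (fun loc k => Seq (Seq (cl loc k) (ci loc k.+1))
   (Seq (While (EVar k) (body loc k)) (Assign k (EVar k.+1)))).
exists (fun g => bl g + bi g + (L g * W g + U g)); split; last first.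
- apply: (pb_le _ HU) => g.
  have H : forall m b, tree_size (tree_of_seq eC m) <= L g ->
      tree_size (eB (foldl (step g) b m)) <= tree_size (eB b) + size m * Gr g.
    elim=> [|c m IH] b /= Hm; first by rewrite mul0n addn0.
    apply: leq_trans (IH _ _) _; first by lia.
    rewrite mulSn addnA leq_add2r; apply: leq_trans (Hgr g b c) _.
    rewrite leq_add2l /Gr; case: (dg) => // d; rewrite leq_exp2r //.
    by rewrite leq_add2l; lia.
  apply: leq_trans (H _ _ (leqnn _)) _.
  by rewrite /U leq_add2l leq_mul2r (ltnW (size_le_tree_of_seq _)) orbT.
- by do ![apply: pb_add => //]; apply: pb_mul.
move=> g loc k s Hs Hloc.
have [s1 [t1 [H1 H2 H3 H4]]] := Hcl g loc k s Hs Hloc.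
have [||s2 [t2 [K1 K2 K3 K4]]] := Hci g loc k.+1 s1.
- by rewrite (map_agree Hloc H3).
- exact: all_ltW Hloc.
have [||||s3 [t3 [J1 J2 J3 J4 J5]]] := loop g loc k Hloc (l g) s2 (i g) (leqnn _).
- by rewrite /U leq_add2l leq_mul2r (ltnW (size_le_tree_of_seq _)) orbT.
- by rewrite -Hs; apply: (map_agree Hloc) => j Hj; rewrite K3 ?H3 // ltnW.
- by rewrite K3.
- exact: K2.
exists (update s3 k (s3 k.+1)), (t1 + t2 + (t3 + cost (EVar k.+1) s3)); split.
- apply: ExecSeq; first exact: ExecSeq H1 K1.
  by apply: ExecSeq J1 _; apply: (ExecAssign k (EVar _)).
- by rewrite /update eqxx.
- by move=> j Hj; rewrite /update ltn_eqF // J3 // K3 ?H3 // ltnW.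
rewrite leq_add // leq_add //= ?addn0 //.
by apply: leq_trans J4 _; rewrite leq_mul2r size_le_tree_of_seq orbT.
Qed.

End Fold.
End Computability.

(** * Booleans, unary numbers, pairs and lists as trees *)

Section Encodings.
Local Open Scope nat_scope.

Definition tree_of_pair (A B : Type) (eA : A -> tree) (eB : B -> tree) (p : A * B) :=
  Node (eA p.1) (eB p.2).

(** Seen as a list of units, a unary number turns bounded iteration into a fold and a sum into a
    concatenation. *)
Lemma tree_of_unaryE k : tree_of_unary k = tree_of_seq (fun=> Leaf) (nseq k tt).
Proof. by elim: k => //= k ->. Qed.

Lemma tree_size_unary k : tree_size (tree_of_unary k) = k.*2.+1.
Proof. by elim: k => //= k ->; lia. Qed.

Lemma tree_eq_unary m n : tree_eq (tree_of_unary m) (tree_of_unary n) = (m == n).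
Proof. by elim: m n => [|m IH] [|n] //=; rewrite IH. Qed.

Lemma tree_size_cat (A : Type) (eA : A -> tree) s t :
  (tree_size (tree_of_seq eA (s ++ t))).+1 =
  tree_size (tree_of_seq eA s) + tree_size (tree_of_seq eA t).
Proof. by elim: s => //= a s IH; rewrite addSn -addnA -IH addnS. Qed.

Lemma tree_size_mem (A : eqType) (eA : A -> tree) a s :
  a \in s -> tree_size (eA a) < tree_size (tree_of_seq eA s).
Proof.
elim: s => //= b s IH; rewrite in_cons => /predU1P[->|/IH H].
  by rewrite ltnS leq_addr.
by rewrite ltnS; apply: leq_trans (leq_addl _ _); apply: ltnW.
Qed.

Section Basic.
Variables (Gam : Type) (es : seq (Gam -> tree)).

Lemma pt_pb f : ptime es f -> poly_bounded es (fun g => tree_size (f g)).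
Proof. by case=> c [b []]. Qed.

Lemma pt_ite (A : Type) (eA : A -> tree) q (f h : Gam -> A) :
  ptime es (fun g => tree_of_bool (q g)) ->
  ptime es (fun g => eA (f g)) -> ptime es (fun g => eA (h g)) ->
  ptime es (fun g => eA (if q g then f g else h g)).
Proof.
move=> Hq Hf Hh; apply: pt_ext (pt_if Hq Hf Hh) => g.
by case: (q g).
Qed.

Lemma pt_true : ptime es (fun=> tree_of_bool true).
Proof. by apply: pt_node; apply: pt_leaf. Qed.

Lemma pt_false : ptime es (fun=> tree_of_bool false).
Proof. exact: pt_leaf. Qed.

Lemma pt_negb q : ptime es (fun g => tree_of_bool (q g)) ->
  ptime es (fun g => tree_of_bool (~~ q g)).
Proof.
move=> Hq; apply: pt_ext (pt_if Hq pt_false pt_true) => g.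
by case: (q g).
Qed.

Lemma pt_andb q r : ptime es (fun g => tree_of_bool (q g)) ->
  ptime es (fun g => tree_of_bool (r g)) ->
  ptime es (fun g => tree_of_bool (q g && r g)).
Proof.
move=> Hq Hr; apply: pt_ext (pt_if Hq Hr pt_false) => g.
by case: (q g).
Qed.

Lemma pt_orb q r : ptime es (fun g => tree_of_bool (q g)) ->
  ptime es (fun g => tree_of_bool (r g)) ->
  ptime es (fun g => tree_of_bool (q g || r g)).
Proof.
move=> Hq Hr; apply: pt_ext (pt_if Hq pt_true Hr) => g.
by case: (q g).
Qed.

Lemma pt_zero : ptime es (fun=> tree_of_unary 0).
Proof. exact: pt_leaf. Qed.

Lemma pt_succ n : ptime es (fun g => tree_of_unary (n g)) ->
  ptime es (fun g => tree_of_unary (n g).+1).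
Proof. by move=> H; apply: pt_node => //; apply: pt_leaf. Qed.

Lemma pt_pred n : ptime es (fun g => tree_of_unary (n g)) ->
  ptime es (fun g => tree_of_unary (n g).-1).
Proof. by move=> H; apply: pt_ext (pt_tail H) => g; case: (n g). Qed.

Lemma pt_eqn m n : ptime es (fun g => tree_of_unary (m g)) ->
  ptime es (fun g => tree_of_unary (n g)) ->
  ptime es (fun g => tree_of_bool (m g == n g)).
Proof.
by move=> Hm Hn; apply: pt_ext (pt_tree_eq Hm Hn) => g; rewrite tree_eq_unary.
Qed.

Lemma pt_bool_nat q : ptime es (fun g => tree_of_bool (q g)) ->
  ptime es (fun g => tree_of_unary (q g)).
Proof. by apply: pt_ext => g; case: (q g). Qed.

Section Pairs.
Variables (A B : Type) (eA : A -> tree) (eB : B -> tree).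

Lemma pt_pair f h : ptime es (fun g => eA (f g)) -> ptime es (fun g => eB (h g)) ->
  ptime es (fun g => tree_of_pair eA eB (f g, h g)).
Proof. exact: pt_node. Qed.

Lemma pt_fst f : ptime es (fun g => tree_of_pair eA eB (f g)) ->
  ptime es (fun g => eA (f g).1).
Proof. exact: pt_head. Qed.

Lemma pt_snd f : ptime es (fun g => tree_of_pair eA eB (f g)) ->
  ptime es (fun g => eB (f g).2).
Proof. exact: pt_tail. Qed.

Lemma pt_nil : ptime es (fun=> tree_of_seq eA [::]).
Proof. exact: pt_leaf. Qed.

Lemma pt_cons f h : ptime es (fun g => eA (f g)) ->
  ptime es (fun g => tree_of_seq eA (h g)) ->
  ptime es (fun g => tree_of_seq eA (f g :: h g)).
Proof. exact: pt_node. Qed.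

Lemma pt_behead h : ptime es (fun g => tree_of_seq eA (h g)) ->
  ptime es (fun g => tree_of_seq eA (behead (h g))).
Proof. by move=> H; apply: pt_ext (pt_tail H) => g; case: (h g). Qed.

Lemma pt_nilp h : ptime es (fun g => tree_of_seq eA (h g)) ->
  ptime es (fun g => tree_of_bool (nilp (h g))).
Proof.
by move=> H; apply: pt_ext (pt_tree_eq H (@pt_leaf _ _)) => g; case: (h g).
Qed.

Lemma pt_head_default x0 h : ptime es (fun=> eA x0) ->
  ptime es (fun g => tree_of_seq eA (h g)) ->
  ptime es (fun g => eA (head x0 (h g))).
Proof.
move=> Hx H; apply: pt_ext (pt_if (pt_nilp H) Hx (pt_head H)) => g.
by case: (h g).
Qed.

End Pairs.
End Basic.

Lemma elem_subst (Gam C X : Type) (eC : C -> tree) (es : seq (Gam -> tree))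
    (ds : seq (Gam * X -> tree)) (pi : Gam * X -> C) :
  ptime ds (fun p => eC (pi p)) ->
  ptimes ds [seq (fun p => e p.1) | e <- es] ->
  forall f, ptime (elem_env eC es) f -> ptime ds (fun p => f (p.1, pi p)).
Proof.
move=> Hp Hd f; apply: (pt_subst (phi := fun p => (p.1, pi p))).
by split=> //; rewrite -map_comp.
Qed.

Section Sequences.
Variables (Gam : Type) (es : seq (Gam -> tree)).

Lemma pt_iter (B : Type) (eB : B -> tree) (n : Gam -> nat) (step : Gam -> B -> B) i :
  ptime es (fun g => tree_of_unary (n g)) ->
  ptime es (fun g => eB (i g)) ->
  ptime (elem_env eB es) (fun p => eB (step p.1 p.2)) ->
  (exists2 G, poly_bounded es G & forall g b, tree_size (eB (step g b)) <= tree_size (eB b) + G g) ->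
  ptime es (fun g => eB (iter (n g) (step g) (i g))).
Proof.
move=> Hn Hi Hs [G HG Hgr].
have E g : foldl (fun b _ => step g b) (i g) (nseq (n g) tt) = iter (n g) (step g) (i g).
  by elim: (n g) (i g) => //= m IH b; rewrite IH -iterSr.
apply: (pt_ext (fun g => congr1 eB (E g))).
apply: (pt_fold (eC := fun=> Leaf) (l := fun g => nseq (n g) tt)
  (step := fun g b _ => step g b)) => //.
- by apply: pt_ext Hn => g; rewrite tree_of_unaryE.
- apply: (elem_subst (pi := fun p => p.2.2) _ _ Hs).
    exact: (pt_var_nth (i := 1)).
  exact: (ptimes_catr [:: _; _]).
- exists (G \o fst) => //.
  apply: (pb_subst _ HG); exact: (ptimes_catr [:: _]).
Qed.

Lemma pt_addn m n : ptime es (fun g => tree_of_unary (m g)) ->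
  ptime es (fun g => tree_of_unary (n g)) ->
  ptime es (fun g => tree_of_unary (m g + n g)).
Proof.
move=> Hm Hn; have E g : iter (m g) succn (n g) = m g + n g.
  by elim: (m g) => //= k ->.
apply: (pt_ext (fun g => congr1 tree_of_unary (E g))).
apply: (pt_iter (step := fun=> succn)) => //.
  by apply: pt_succ; exact: (pt_var_nth (i := 0)).
exists (fun=> 2); first exact: pb_const.
by move=> g b; rewrite !tree_size_unary; lia.
Qed.

Lemma pt_subn m n : ptime es (fun g => tree_of_unary (m g)) ->
  ptime es (fun g => tree_of_unary (n g)) ->
  ptime es (fun g => tree_of_unary (m g - n g)).
Proof.
move=> Hm Hn; have E g : iter (n g) predn (m g) = m g - n g.
  by elim: (n g) => [|k /= ->]; rewrite ?subn0 // subnS.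
apply: (pt_ext (fun g => congr1 tree_of_unary (E g))).
apply: (pt_iter (step := fun=> predn)) => //.
  by apply: pt_pred; exact: (pt_var_nth (i := 0)).
exists (fun=> 0); first exact: pb_const.
by move=> g b; rewrite !tree_size_unary; lia.
Qed.

Lemma pt_leq m n : ptime es (fun g => tree_of_unary (m g)) ->
  ptime es (fun g => tree_of_unary (n g)) ->
  ptime es (fun g => tree_of_bool (m g <= n g)).
Proof.
by move=> Hm Hn; apply: pt_eqn; [apply: pt_subn | apply: pt_zero].
Qed.

Section Concatenation.
Variables (A : Type) (eA : A -> tree).

Lemma pt_catrev s t : ptime es (fun g => tree_of_seq eA (s g)) ->
  ptime es (fun g => tree_of_seq eA (t g)) ->
  ptime es (fun g => tree_of_seq eA (catrev (s g) (t g))).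
Proof.
move=> Hs Ht; have E g : foldl (fun b c => c :: b) (t g) (s g) = catrev (s g) (t g).
  by elim: (s g) (t g) => //= a s' IH t'.
apply: (pt_ext (fun g => congr1 (tree_of_seq eA) (E g))).
apply: (pt_fold (step := fun _ b c => c :: b)) Hs Ht _ _.
  apply: pt_cons; first exact: (pt_var_nth (i := 0)).
  exact: (pt_var_nth (i := 1)).
exists (fun p => (tree_size (eA p.2)).+1).
  apply: (@pb_le _ _ _ (fun p => tree_size (eA p.2) + 1)).
    by move=> p; rewrite addn1.
  apply: pb_add; last exact: pb_const.
  by apply: pt_pb; exact: (pt_var_nth (i := 0)).
by move=> g b c /=; lia.
Qed.

Lemma pt_cat s t : ptime es (fun g => tree_of_seq eA (s g)) ->
  ptime es (fun g => tree_of_seq eA (t g)) ->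
  ptime es (fun g => tree_of_seq eA (s g ++ t g)).
Proof.
move=> Hs Ht.
have E g : catrev (catrev (s g) [::]) (t g) = s g ++ t g.
  by rewrite [catrev (s g) _]catrevE cats0 catrevE revK.
apply: (pt_ext (fun g => congr1 (tree_of_seq eA) (E g))).
by do 2?apply: pt_catrev => //; apply: pt_nil.
Qed.

End Concatenation.
End Sequences.

Section Flatten.
Variables (Gam : Type) (es : seq (Gam -> tree)).

(** Maps, filters and sums are instances of this rule: a filter flattens lists of length at most
    one, a sum flattens lists of units. Concatenation grows the accumulator by no more than the new
    piece, so the growth is additive. *)
Lemma pt_flatten (A C : Type) (eA : A -> tree) (eC : C -> tree) l (F : Gam -> C -> seq A) :
  ptime es (fun g => tree_of_seq eC (l g)) ->
  ptime (elem_env eC es) (fun p => tree_of_seq eA (F p.1 p.2)) ->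
  ptime es (fun g => tree_of_seq eA (flatten [seq F g c | c <- l g])).
Proof.
move=> Hl HF.
have E g : foldl (fun b c => b ++ F g c) [::] (l g) = flatten [seq F g c | c <- l g].
  rewrite -[RHS]cat0s; elim: (l g) [::] => [|c l' IH] b /=; first by rewrite cats0.
  by rewrite IH catA.
apply: (pt_ext (fun g => congr1 (tree_of_seq eA) (E g))).
apply: (pt_fold (step := fun g b c => b ++ F g c)) Hl (pt_nil _ _) _ _.
  apply: pt_cat.
    exact: (pt_var_nth (i := 1)).
  apply: (elem_subst (pi := fun p => p.2.1) _ _ HF).
    exact: (pt_var_nth (i := 0)).
  exact: (ptimes_catr [:: _; _]).
exists (fun p => tree_size (tree_of_seq eA (F p.1 p.2))); first exact: pt_pb HF.
by move=> g b c; rewrite -tree_size_cat.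
Qed.

End Flatten.

Section Maps.
Variables (Gam : Type) (es : seq (Gam -> tree)).

Lemma pt_map (A C : Type) (eA : A -> tree) (eC : C -> tree) l F :
  ptime es (fun g => tree_of_seq eC (l g)) ->
  ptime (elem_env eC es) (fun p => eA (F p.1 p.2)) ->
  ptime es (fun g => tree_of_seq eA [seq F g c | c <- l g]).
Proof.
move=> Hl HF; have E g : flatten [seq [:: F g c] | c <- l g] = [seq F g c | c <- l g].
  by elim: (l g) => //= c l' ->.
apply: (pt_ext (fun g => congr1 (tree_of_seq eA) (E g))).
by apply: (pt_flatten (F := fun g c => [:: F g c])) Hl _; apply: pt_cons => //; apply: pt_nil.
Qed.

Section Predicates.
Variables (C : Type) (eC : C -> tree) (l : Gam -> seq C) (p : Gam -> C -> bool).
Hypothesis Hl : ptime es (fun g => tree_of_seq eC (l g)).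
Hypothesis Hp : ptime (elem_env eC es) (fun x => tree_of_bool (p x.1 x.2)).

Lemma pt_filter : ptime es (fun g => tree_of_seq eC [seq c <- l g | p g c]).
Proof.
have E g : flatten [seq if p g c then [:: c] else [::] | c <- l g] = filter (p g) (l g).
  by elim: (l g) => //= c l' ->; case: (p g c).
apply: (pt_ext (fun g => congr1 (tree_of_seq eC) (E g))).
apply: (pt_flatten (F := fun g c => if p g c then [:: c] else [::])) Hl _.
apply: pt_ite => //; last exact: pt_nil.
by apply: pt_cons; [exact: (pt_var_nth (i := 0)) | exact: pt_nil].
Qed.

Lemma pt_has : ptime es (fun g => tree_of_bool (has (p g) (l g))).
Proof.
have E g : ~~ nilp (filter (p g) (l g)) = has (p g) (l g).
  by rewrite /nilp size_filter -lt0n has_count.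
apply: (pt_ext (fun g => congr1 tree_of_bool (E g))).
by apply: pt_negb; apply: pt_nilp; exact: pt_filter.
Qed.

End Predicates.

Lemma pt_sumn (C : Type) (eC : C -> tree) l (F : Gam -> C -> nat) :
  ptime es (fun g => tree_of_seq eC (l g)) ->
  ptime (elem_env eC es) (fun p => tree_of_unary (F p.1 p.2)) ->
  ptime es (fun g => tree_of_unary (sumn [seq F g c | c <- l g])).
Proof.
move=> Hl HF.
have E g : size (flatten [seq nseq (F g c) tt | c <- l g]) = sumn [seq F g c | c <- l g].
  by rewrite size_flatten /shape -map_comp; congr sumn; apply: eq_map => c /=; rewrite size_nseq.
have E2 g : tree_of_seq (fun=> Leaf) (flatten [seq nseq (F g c) tt | c <- l g]) =
    tree_of_unary (sumn [seq F g c | c <- l g]).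
  rewrite -E tree_of_unaryE; congr tree_of_seq.
  by elim: (flatten _) => //= [[]] s' <-.
apply: (pt_ext E2).
apply: (pt_flatten (F := fun g c => nseq (F g c) tt)) Hl _.
by apply: pt_ext HF => x; rewrite tree_of_unaryE.
Qed.

Lemma pt_count (C : Type) (eC : C -> tree) l (p : Gam -> C -> bool) :
  ptime es (fun g => tree_of_seq eC (l g)) ->
  ptime (elem_env eC es) (fun x => tree_of_bool (p x.1 x.2)) ->
  ptime es (fun g => tree_of_unary (count (p g) (l g))).
Proof.
move=> Hl Hp.
have E g : sumn [seq nat_of_bool (p g c) | c <- l g] = count (p g) (l g).
  by rewrite -sumn_count.
apply: (pt_ext (fun g => congr1 tree_of_unary (E g))).
by apply: (pt_sumn (F := fun g c => nat_of_bool (p g c))) Hl _; apply: pt_bool_nat.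
Qed.

Lemma pt_size (C : Type) (eC : C -> tree) l :
  ptime es (fun g => tree_of_seq eC (l g)) ->
  ptime es (fun g => tree_of_unary (size (l g))).
Proof.
move=> Hl; apply: (pt_ext (fun g => congr1 tree_of_unary (count_predT (l g)))).
exact: (pt_count (p := fun _ _ => true)) Hl (pt_true _).
Qed.

Lemma pt_muln m n : ptime es (fun g => tree_of_unary (m g)) ->
  ptime es (fun g => tree_of_unary (n g)) ->
  ptime es (fun g => tree_of_unary (m g * n g)).
Proof.
move=> Hm Hn.
have E g : sumn [seq n g | c <- nseq (m g) tt] = m g * n g.
  by elim: (m g) => //= k ->.
apply: (pt_ext (fun g => congr1 tree_of_unary (E g))).
apply: (pt_sumn (eC := fun=> Leaf) (F := fun g _ => n g)).
  by apply: pt_ext Hm => g; rewrite tree_of_unaryE.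
apply: (pt_subst (phi := fst)) Hn; exact: (ptimes_catr [:: _]).
Qed.

Lemma pt_nth (A : Type) (eA : A -> tree) x0 s i : ptime es (fun=> eA x0) ->
  ptime es (fun g => tree_of_seq eA (s g)) ->
  ptime es (fun g => tree_of_unary (i g)) ->
  ptime es (fun g => eA (nth x0 (s g) (i g))).
Proof.
move=> Hx Hs Hi.
have E g : head x0 (iter (i g) behead (s g)) = nth x0 (s g) (i g).
  elim: (i g) (s g) => [|k IH] [|a s'] //; rewrite iterSr IH //.
  by rewrite /= !nth_nil.
apply: (pt_ext (fun g => congr1 eA (E g))).
apply: pt_head_default => //.
apply: (pt_iter (step := fun=> behead)) => //.
  by apply: pt_behead; exact: (pt_var_nth (i := 0)).
exists (fun=> 0); first exact: pb_const.
by move=> g [|a b] //=; lia.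
Qed.

End Maps.
End Encodings.

(** * The algorithm *)

Section Algorithm.
Local Open Scope nat_scope.
Variables (T : eqType) (touch : rel T) (x0 : T).
Implicit Types (E L M s : seq T) (a b e f g : T).

Definition conflict E a b : bool := has (fun g => touch a g && touch g b) E.

(** An entry of [A^2 + I], the matrix of the quadratic form to be minimized. *)
Definition overlap E a b : nat := count (fun g => touch a g && touch g b) E + (a == b).

Definition argmin (w : T -> nat) s : T :=
  foldl (fun a b => if w b < w a then b else a) (head x0 s) s.

(** The edge of least partial derivative is the vertex of the simplex that Frank-Wolfe moves
    towards. With [k] edges in [L] the iterate is [L / k], and adding an edge is a step of length
    [1 / k.+1], so integers suffice. *)
Definition fw_step E L : seq T :=
  if nilp E then L else argmin (fun e => sumn [seq overlap E e f | f <- L]) E :: L.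

Definition frank_wolfe E k : seq T := iter k (fw_step E) [::].

Definition unblocked E L M : seq T := [seq b <- L | ~~ has (conflict E b) M].

Definition pick_step E L M : seq T :=
  if nilp (unblocked E L M) then M
  else argmin (fun a => count (conflict E a) (unblocked E L M)) (unblocked E L M) :: M.

Definition rounding E L : seq T := iter (size L) (pick_step E L) [::].

(** For [f = g] in [E] and a reflexive [touch], the candidate is the single edge [f]; the double
    loop over pairs thus tries single insertions too. *)
Definition candidate E f g : seq T := if conflict E f g then [:: f] else [:: f; g].

Definition exchange E M c : seq T := c ++ unblocked E M c.

Definition swap E M f g : seq T :=
  if size M < size (exchange E M (candidate E f g))
  then exchange E M (candidate E f g) else M.

Definition swaps E M : seq T := foldl (fun M f => foldl (fun M g => swap E M f g) M E) M E.

Definition local_search E M : seq T := iter (size E).+1 (swaps E) M.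

(** After [s^2] rounds the harmonic sum in the error of Frank-Wolfe is at most [2 s], so the error,
    scaled to mass [X], is at most [2 X^2 (|E| + 1) / s]. As [X <= |E|], this choice of [s] makes it
    at most [X / 2]. *)
Definition sqrt_rounds E : nat := 4 * ((size E).+1 * (size E).+1).

Definition matching_of E : seq T :=
  local_search E (rounding E (frank_wolfe E (sqrt_rounds E * sqrt_rounds E))).

Lemma mem_argmin_cons w a s : argmin w (a :: s) \in a :: s.
Proof.
have H t c : foldl (fun a b => if w b < w a then b else a) c t \in c :: t.
  elim: t c => [|b t IH] c /=; first by rewrite mem_head.
  have := IH (if w b < w c then b else c); rewrite !inE => /orP[/eqP->|->].
    by case: ifP; rewrite eqxx ?orbT.
  by rewrite !orbT.
by rewrite /argmin /= ltnn.
Qed.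

Lemma mem_argmin w s : argmin w s \in x0 :: s.
Proof. by case: s => [|a s]; rewrite in_cons ?mem_argmin_cons ?orbT // eqxx. Qed.

End Algorithm.

(** * Running time of the algorithm *)

Section AlgorithmTime.
Local Open Scope nat_scope.

Definition share {V : eqType} (a b : V * V) : bool :=
  [|| a.1 == b.1, a.1 == b.2, a.2 == b.1 | a.2 == b.2].

Definition tree_of_arc : nat * nat -> tree := tree_of_pair tree_of_unary tree_of_unary.

Notation arcs := (tree_of_seq tree_of_arc).
Notation O2 := (0, 0).

Section Weakening.
Variables (Gam C : Type) (es : seq (Gam -> tree)) (eC : C -> tree).

Lemma pt_weak f : ptime es f -> ptime (elem_env eC es) (fun p => f p.1).
Proof. apply: (pt_subst (phi := fst)); exact: (ptimes_catr [:: _]). Qed.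

Lemma pt_elem : ptime (elem_env eC es) (fun p => eC p.2).
Proof. exact: (pt_var_nth (i := 0)). Qed.

End Weakening.
Hint Resolve pt_weak pt_elem : core.

Section Arcs.
Variables (Gam : Type) (es : seq (Gam -> tree)).

Lemma pt_eq_arc f h : ptime es (fun g => tree_of_arc (f g)) ->
  ptime es (fun g => tree_of_arc (h g)) ->
  ptime es (fun g => tree_of_bool (f g == h g)).
Proof.
move=> Hf Hh; apply: (@pt_ext _ _ (fun g => tree_of_bool (((f g).1 == (h g).1) && ((f g).2 == (h g).2)))).
  by [].
by apply: pt_andb; apply: pt_eqn; [exact: pt_fst Hf | exact: pt_fst Hh | exact: pt_snd Hf | exact: pt_snd Hh].
Qed.

Lemma pt_share f h : ptime es (fun g => tree_of_arc (f g)) ->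
  ptime es (fun g => tree_of_arc (h g)) ->
  ptime es (fun g => tree_of_bool (share (f g) (h g))).
Proof.
move=> Hf Hh.
have [Hf1 Hf2 Hh1 Hh2] := And4 (pt_fst Hf) (pt_snd Hf) (pt_fst Hh) (pt_snd Hh).
by do 3?[apply: pt_orb; first exact: pt_eqn]; apply: pt_eqn.
Qed.

Lemma pt_O2 : ptime es (fun=> tree_of_arc O2).
Proof. by apply: pt_pair; apply: pt_zero. Qed.

End Arcs.

Section Conflicts.
Variables (Gam : Type) (es : seq (Gam -> tree)) (E : Gam -> seq (nat * nat)).
Hypothesis HE : ptime es (fun g => arcs (E g)).

Section TwoArcs.
Variables (f h : Gam -> nat * nat).
Hypotheses (Hf : ptime es (fun g => tree_of_arc (f g)))
  (Hh : ptime es (fun g => tree_of_arc (h g))).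

Lemma pt_conflict : ptime es (fun g => tree_of_bool (conflict share (E g) (f g) (h g))).
Proof.
apply: (pt_has (p := fun g c => share (f g) c && share c (h g))) HE _.
apply: pt_andb; apply: pt_share; by [exact: pt_elem | exact: pt_weak Hf | exact: pt_weak Hh].
Qed.

Lemma pt_overlap : ptime es (fun g => tree_of_unary (overlap share (E g) (f g) (h g))).
Proof.
apply: pt_addn; last by apply: pt_bool_nat; apply: pt_eq_arc.
apply: (pt_count (p := fun g c => share (f g) c && share c (h g))) HE _.
apply: pt_andb; apply: pt_share; by [exact: pt_elem | exact: pt_weak Hf | exact: pt_weak Hh].
Qed.

Lemma pt_candidate : ptime es (fun g => arcs (candidate share (E g) (f g) (h g))).
Proof.
apply: pt_ite; first exact: pt_conflict.
  by apply: pt_cons => //; apply: pt_nil.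
by do 2?apply: pt_cons => //; apply: pt_nil.
Qed.

End TwoArcs.
End Conflicts.

Section Argmin.
Variables (Gam : Type) (es : seq (Gam -> tree)).

Lemma pt_argmin (w : Gam -> nat * nat -> nat) s :
  ptime es (fun g => arcs (s g)) ->
  ptime (elem_env tree_of_arc es) (fun p => tree_of_unary (w p.1 p.2)) ->
  ptime es (fun g => tree_of_arc (argmin O2 (w g) (s g))).
Proof.
move=> Hs Hw.
apply: (pt_fold (eC := tree_of_arc) (step := fun g a b => if w g b < w g a then b else a)) => //.
- by apply: pt_head_default => //; apply: pt_O2.
- have Hb : ptime (fold_env es tree_of_arc tree_of_arc) (fun p => tree_of_arc p.2.1).
    exact: (pt_var_nth (i := 0)).
  have Ha : ptime (fold_env es tree_of_arc tree_of_arc) (fun p => tree_of_arc p.2.2).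
    exact: (pt_var_nth (i := 1)).
  have Hes : ptimes (fold_env es tree_of_arc tree_of_arc) [seq (fun p => e p.1) | e <- es].
    exact: (ptimes_catr [:: _; _]).
  apply: pt_ite => //; apply: pt_leq; first apply: pt_succ.
    exact: (elem_subst (pi := fun p => p.2.1) Hb Hes Hw).
  exact: (elem_subst (pi := fun p => p.2.2) Ha Hes Hw).
exists (fun p => tree_size (tree_of_arc p.2)); first exact: pt_pb (pt_elem _ _).
by move=> g a b /=; case: ifP => _; rewrite ?leq_addr ?leq_addl.
Qed.

(** The 3 is the size of the encoded default arc [(0, 0)], which is returned on an empty list. *)
Lemma argmin_size w s : tree_size (tree_of_arc (argmin O2 w s)) <= 3 + tree_size (arcs s).
Proof.
have := mem_argmin O2 w s; rewrite inE => /predU1P[->|H]; first exact: leq_addr.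
by apply: leq_trans (leq_addl _ _); apply: ltnW; apply: tree_size_mem.
Qed.

End Argmin.

Section FrankWolfe.
Variables (Gam : Type) (es : seq (Gam -> tree)).

Lemma pt_frank_wolfe E k : ptime es (fun g => arcs (E g)) ->
  ptime es (fun g => tree_of_unary (k g)) ->
  ptime es (fun g => arcs (frank_wolfe share O2 (E g) (k g))).
Proof.
move=> HE Hk.
apply: (pt_iter (step := fun g => fw_step share O2 (E g))) => //; first exact: pt_nil.
  have HE' := pt_weak arcs HE.
  apply: pt_ite; [exact: pt_nilp HE' | exact: pt_elem | apply: pt_cons; last exact: pt_elem].
  apply: (pt_argmin (w := fun p e => sumn [seq overlap share (E p.1) e f | f <- p.2]) HE').
  apply: (pt_sumn (l := fun q => q.1.2) (F := fun q f => overlap share (E q.1.1) q.2 f)).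
    exact: pt_weak (pt_elem _ _).
  apply: pt_overlap; last exact: pt_elem.
    exact: pt_weak (pt_weak _ HE').
  exact: pt_weak (pt_elem _ _).
exists (fun g => 4 + tree_size (arcs (E g))).
  by apply: pb_add; [exact: pb_const | exact: pt_pb].
move=> g L; rewrite /fw_step; case: nilP => _; first exact: leq_addr.
by rewrite /= addnC -addnS leq_add2l addSn ltnS argmin_size.
Qed.

End FrankWolfe.

Section Unblocked.
Variables (Gam : Type) (es : seq (Gam -> tree)).
Variables E L M : Gam -> seq (nat * nat).
Hypotheses (HE : ptime es (fun g => arcs (E g))) (HL : ptime es (fun g => arcs (L g)))
  (HM : ptime es (fun g => arcs (M g))).

Lemma pt_unblocked : ptime es (fun g => arcs (unblocked share (E g) (L g) (M g))).
Proof.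
apply: (pt_filter (p := fun g b => ~~ has (conflict share (E g) b) (M g))) HL _.
apply: pt_negb.
apply: (pt_has (p := fun q c => conflict share (E q.1) q.2 c)); first exact: pt_weak HM.
by apply: pt_conflict; [exact: pt_weak (pt_weak _ HE) | exact: pt_weak (pt_elem _ _) | exact: pt_elem].
Qed.

End Unblocked.

Lemma tree_size_filter (p : pred (nat * nat)) s :
  tree_size (arcs (filter p s)) <= tree_size (arcs s).
Proof. by elim: s => //= a s IH; case: (p a) => /=; lia. Qed.

Lemma foldl_size (B C : Type) (eB : B -> tree) (step : B -> C -> B) (n : C -> nat) (s : seq C) b :
  (forall b c, tree_size (eB (step b c)) <= tree_size (eB b) + n c) ->
  tree_size (eB (foldl step b s)) <= tree_size (eB b) + sumn (map n s).
Proof.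
move=> H; elim: s b => [|c s IH] b /=; first by rewrite addn0.
by apply: leq_trans (IH _) _; rewrite addnA leq_add2r.
Qed.

(** Apart from deletions a swap only adds the candidate, at most two arcs, so its growth is additive
    as the rule for folds demands. *)
Lemma swap_size E M f g :
  tree_size (arcs (swap share E M f g)) <=
  tree_size (arcs M) + (2 + tree_size (tree_of_arc f) + tree_size (tree_of_arc g)).
Proof.
rewrite /swap; case: ifP => _; last exact: leq_addr.
have H : tree_size (arcs (candidate share E f g)) <=
    3 + tree_size (tree_of_arc f) + tree_size (tree_of_arc g).
  by rewrite /candidate; case: ifP => _ /=; lia.
have := tree_size_cat tree_of_arc (candidate share E f g) (unblocked share E M (candidate share E f g)).
rewrite -/(exchange _ _ _ _).
have : tree_size (arcs (unblocked share E M (candidate share E f g))) <= tree_size (arcs M).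
  exact: tree_size_filter.
by move: H; set u := tree_size _; set v := tree_size _; set w := tree_size (arcs M); lia.
Qed.

Section Rounds.
Variables (Gam : Type) (es : seq (Gam -> tree)).

Lemma pt_rounding E L : ptime es (fun g => arcs (E g)) ->
  ptime es (fun g => arcs (L g)) ->
  ptime es (fun g => arcs (rounding share O2 (E g) (L g))).
Proof.
move=> HE HL.
apply: (pt_iter (step := fun g => pick_step share O2 (E g) (L g))); first exact: pt_size HL.
- exact: pt_nil.
- have HF : ptime (elem_env arcs es) (fun p => arcs (unblocked share (E p.1) (L p.1) p.2)).
    by apply: pt_unblocked; [exact: pt_weak HE | exact: pt_weak HL | exact: pt_elem].
  apply: pt_ite; [exact: pt_nilp HF | exact: pt_elem | apply: pt_cons; last exact: pt_elem].
  apply: (pt_argmin (w := fun p a =>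
    count (conflict share (E p.1) a) (unblocked share (E p.1) (L p.1) p.2)) HF).
  apply: (pt_count (l := fun q => unblocked share (E q.1.1) (L q.1.1) q.1.2)
    (p := fun q c => conflict share (E q.1.1) q.2 c)).
    exact: pt_weak HF.
  apply: pt_conflict; last exact: pt_elem.
    exact: pt_weak (pt_weak _ (pt_weak _ HE)).
  exact: pt_weak (pt_elem _ _).
exists (fun g => 4 + tree_size (arcs (L g))).
  by apply: pb_add; [exact: pb_const | exact: pt_pb].
move=> g M; rewrite /pick_step; case: nilP => _; first exact: leq_addr.
rewrite /= addnC -addnS leq_add2l addSn ltnS.
by apply: leq_trans (argmin_size _ _) _; rewrite leq_add2l tree_size_filter.
Qed.

Lemma pt_swap E M f h : ptime es (fun g => arcs (E g)) ->
  ptime es (fun g => arcs (M g)) -> ptime es (fun g => tree_of_arc (f g)) ->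
  ptime es (fun g => tree_of_arc (h g)) ->
  ptime es (fun g => arcs (swap share (E g) (M g) (f g) (h g))).
Proof.
move=> HE HM Hf Hh.
have HX : ptime es (fun g => arcs (exchange share (E g) (M g) (candidate share (E g) (f g) (h g)))).
  by apply: pt_cat; last apply: pt_unblocked => //; apply: pt_candidate.
by apply: pt_ite => //; apply: pt_leq; [apply: pt_succ|]; apply: pt_size; eassumption.
Qed.

End Rounds.

Lemma sumn_map_le (C : eqType) (n : C -> nat) (s : seq C) k :
  (forall c, c \in s -> n c <= k) -> sumn (map n s) <= size s * k.
Proof.
elim: s => //= c s IH H; rewrite mulSn leq_add ?H ?mem_head //.
by apply: IH => d Hd; rewrite H // inE Hd orbT.
Qed.

Section Swaps.

Definition row_growth E f :=
  tree_size (arcs E) * (2 + tree_size (tree_of_arc f) + tree_size (arcs E)).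

Lemma swap_row_size E M f :
  tree_size (arcs (foldl (fun M g => swap share E M f g) M E)) <=
  tree_size (arcs M) + row_growth E f.
Proof.
apply: leq_trans (foldl_size _ _ (fun M' g => swap_size E M' f g)) _.
rewrite leq_add2l /row_growth.
apply: leq_trans (sumn_map_le (k := 2 + tree_size (tree_of_arc f) + tree_size (arcs E)) _) _.
  move=> g /(tree_size_mem tree_of_arc)/ltnW Hg; rewrite leq_add2l; exact: Hg.
by rewrite leq_mul2r (ltnW (size_le_tree_of_seq _ _)) orbT.
Qed.

Lemma swaps_size E M : tree_size (arcs (swaps share E M)) <=
  tree_size (arcs M) +
  tree_size (arcs E) * (tree_size (arcs E) * (2 + tree_size (arcs E) + tree_size (arcs E))).
Proof.
apply: leq_trans (foldl_size _ _ (swap_row_size E)) _.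
rewrite leq_add2l; apply: leq_trans (sumn_map_le
  (k := tree_size (arcs E) * (2 + tree_size (arcs E) + tree_size (arcs E))) _) _.
  move=> f /(tree_size_mem tree_of_arc)/ltnW Hf.
  by rewrite /row_growth leq_mul2l leq_add2r leq_add2l Hf orbT.
by rewrite leq_mul2r (ltnW (size_le_tree_of_seq _ _)) orbT.
Qed.

Lemma pt_swap_row (Gam : Type) (es : seq (Gam -> tree)) E M f :
  ptime es (fun g => arcs (E g)) -> ptime es (fun g => arcs (M g)) ->
  ptime es (fun g => tree_of_arc (f g)) ->
  ptime es (fun g => arcs (foldl (fun M h => swap share (E g) M (f g) h) (M g) (E g))).
Proof.
move=> HE HM Hf.
have Hes : ptimes (fold_env es tree_of_arc arcs) [seq (fun p => e p.1) | e <- es].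
  exact: (ptimes_catr [:: _; _]).
apply: (pt_fold (step := fun g M h => swap share (E g) M (f g) h) HE HM).
  apply: pt_swap.
  - exact: (pt_subst (phi := fst) Hes HE).
  - exact: (pt_var_nth (i := 1)).
  - exact: (pt_subst (phi := fst) Hes Hf).
  exact: (pt_var_nth (i := 0)).
exists (fun p => 2 + tree_size (tree_of_arc (f p.1)) + tree_size (tree_of_arc p.2)).
  apply: pb_add; last exact: pt_pb (pt_elem _ _).
  by apply: pb_add; [exact: pb_const | exact: pt_pb (pt_weak _ Hf)].
by move=> g M' h; apply: swap_size.
Qed.

Lemma pt_swaps (Gam : Type) (es : seq (Gam -> tree)) E M :
  ptime es (fun g => arcs (E g)) -> ptime es (fun g => arcs (M g)) ->
  ptime es (fun g => arcs (swaps share (E g) (M g))).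
Proof.
move=> HE HM.
have Hes : ptimes (fold_env es tree_of_arc arcs) [seq (fun p => e p.1) | e <- es].
  exact: (ptimes_catr [:: _; _]).
apply: (pt_fold (step := fun g M f => foldl (fun M h => swap share (E g) M f h) M (E g)) HE HM).
  apply: (pt_swap_row (E := fun p => E p.1) (M := fun p => p.2.2) (f := fun p => p.2.1)).
  - exact: (pt_subst (phi := fst) Hes HE).
  - exact: (pt_var_nth (i := 1)).
  exact: (pt_var_nth (i := 0)).
exists (fun p => row_growth (E p.1) p.2); last by move=> g M' f; apply: swap_row_size.
have HE' := pt_pb (pt_weak tree_of_arc HE).
apply: pb_mul => //; apply: pb_add => //.
by apply: pb_add; [exact: pb_const | exact: pt_pb (pt_elem _ _)].
Qed.

Lemma pt_local_search (Gam : Type) (es : seq (Gam -> tree)) E M :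
  ptime es (fun g => arcs (E g)) -> ptime es (fun g => arcs (M g)) ->
  ptime es (fun g => arcs (local_search share (E g) (M g))).
Proof.
move=> HE HM.
apply: (pt_iter (step := fun g => swaps share (E g))) => //.
- by apply: pt_succ; exact: pt_size HE.
- by apply: pt_swaps; [exact: pt_weak HE | exact: pt_elem].
eexists; last by move=> g M'; apply: swaps_size.
have HE' := pt_pb HE.
do 2!apply: pb_mul => //; do 2!apply: pb_add => //; exact: pb_const.
Qed.

Lemma pt_matching_of (Gam : Type) (es : seq (Gam -> tree)) E :
  ptime es (fun g => arcs (E g)) ->
  ptime es (fun g => arcs (matching_of share O2 (E g))).
Proof.
move=> HE; apply: pt_local_search => //; apply: pt_rounding => //.
apply: pt_frank_wolfe => //.
have HN : ptime es (fun g => tree_of_unary (size (E g)).+1) by apply/pt_succ/(pt_size HE).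
have HR : ptime es (fun g => tree_of_unary (sqrt_rounds (E g))).
  apply: pt_muln; last exact: pt_muln.
  by do 4!apply: pt_succ; exact: pt_zero.
exact: pt_muln.
Qed.

End Swaps.

(** The growth of a step has to be bounded for an arbitrary accumulator [s]; the test, which
    succeeds throughout the actual run, limits the number that is added to one below the number of
    rows. The list comes out in decreasing order. *)
Definition indices (rows : seq (seq bool)) : seq nat :=
  iter (size rows) (fun s => if size s < size rows then size s :: s else s) [::].

Definition edge_arcs (rows : seq (seq bool)) : seq (nat * nat) :=
  flatten [seq [seq (i, j) | j <- [seq j <- indices rows | (i < j) && nth false (nth [::] rows i) j]]
          | i <- indices rows].

Section Input.
Variables (Gam : Type) (es : seq (Gam -> tree)) (rows : Gam -> seq (seq bool)).
Hypothesis Hrows : ptime es (fun g => tree_of_seq (tree_of_seq tree_of_bool) (rows g)).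

Lemma pt_indices : ptime es (fun g => tree_of_seq tree_of_unary (indices (rows g))).
Proof.
have Hn := pt_size Hrows.
apply: (pt_iter (step := fun g s => if size s < size (rows g) then size s :: s else s)) => //.
  exact: pt_nil.
  have Hs : ptime (elem_env (tree_of_seq tree_of_unary) es) (fun p => tree_of_seq tree_of_unary p.2).
    exact: pt_elem.
  apply: pt_ite => //.
    by apply: pt_leq; [apply: pt_succ; exact: pt_size Hs | exact: pt_weak Hn].
  by apply: pt_cons => //; exact: pt_size Hs.
exists (fun g => tree_size (tree_of_unary (size (rows g))) + 1).
  by apply: pb_add; [exact: pt_pb | exact: pb_const].
move=> g s; case: ifP => H; last exact: leq_addr.
by rewrite /= !tree_size_unary; lia.
Qed.

Lemma pt_edge_arcs : ptime es (fun g => arcs (edge_arcs (rows g))).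
Proof.
have Hi := pt_weak tree_of_unary pt_indices.
have Hi1 : ptime (elem_env tree_of_unary es) (fun p => tree_of_unary p.2) by exact: pt_elem.
apply: (pt_flatten (F := fun g i => [seq (i, j) |
  j <- [seq j <- indices (rows g) | (i < j) && nth false (nth [::] (rows g) i) j]])).
  exact: pt_indices.
apply: (pt_map (eC := tree_of_unary) (F := fun p j => (p.2, j))); last first.
  by apply: pt_pair; [exact: pt_weak Hi1 | exact: pt_elem].
apply: (pt_filter (p := fun p j => (p.2 < j) && nth false (nth [::] (rows p.1) p.2) j) Hi).
have Hi2 : ptime (elem_env tree_of_unary (elem_env tree_of_unary es)) (fun p => tree_of_unary p.2).
  exact: pt_elem.
apply: pt_andb.
  by apply: pt_leq => //; apply: pt_succ; exact: pt_weak Hi1.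
apply: pt_nth; [exact: pt_false | | exact: Hi2].
apply: pt_nth; [exact: pt_nil | exact: pt_weak (pt_weak _ Hrows) | exact: pt_weak Hi1].
Qed.

End Input.

Record instance := Instance { inst_Delta : nat; inst_n : nat; inst_graph : sgraph 'I_inst_n }.

Definition tree_of_inst (i : instance) : tree := tree_of_instance (inst_Delta i) (inst_graph i).

Definition inst_edges (i : instance) : seq (nat * nat) := edge_arcs (adjacency_rows (inst_graph i)).

Lemma matching_of_ptime : exists (p : com) (q : {poly nat}), forall i : instance,
  exists t, computes p (tree_of_inst i) (arcs (matching_of share O2 (inst_edges i))) t /\
    t <= q.[tree_size (tree_of_inst i)]%R.
Proof.
have Hin : ptime [:: tree_of_inst] tree_of_inst by exact: (pt_var_nth (i := 0)).
have Hrows : ptime [:: tree_of_inst]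
    (fun i => tree_of_seq (tree_of_seq tree_of_bool) (adjacency_rows (inst_graph i))).
  exact: (pt_tail Hin).
have [c [b [Hc [d Hb] [e He]]]] := pt_matching_of (pt_edge_arcs Hrows).
exists (Seq (c [:: 0] 1) (Assign 0 (EVar 1))).
(* The second summand pays for the final copy of the result into register 0. *)
exists (('X + 2%:P) ^+ d + ('X + 2%:P) ^+ e)%R => i.
have [||s' [t [H1 H2 H3 H4]]] := Hc i [:: 0] 1 (update (fun=> Leaf) 0 (tree_of_inst i)).
- by [].
- by [].
exists (t + cost (EVar 1) s'); split.
  exists (update s' 0 (s' 1)); last by rewrite /update /= H2.
  by apply: ExecSeq H1 _; apply: (ExecAssign 0 (EVar 1)).
rewrite hornerD !horner_exp !hornerD hornerX hornerC /= addn0 H2.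
move: (Hb i) (He i); rewrite /env_size big_seq1 => Hbi Hei.
apply: leq_add.
  by apply: leq_trans H4 _; apply: leq_trans Hbi _; rewrite -addn2.
by apply: leq_trans Hei _; rewrite -addn2.
Qed.

End AlgorithmTime.

(** * Frank-Wolfe iterations *)

Section FrankWolfe.
Local Open Scope ring_scope.
Variables (R : realFieldType) (T : eqType) (touch : rel T) (x0 : T) (E : seq T).
Hypothesis (touch_sym : symmetric touch) (E_uniq : uniq E).

Lemma argmin_le (w : T -> nat) s a : a \in s -> (w (argmin x0 w s) <= w a)%N.
Proof.
have H t c : let m := foldl (fun a b => if (w b < w a)%N then b else a) c t in
    (w m <= w c)%N /\ forall b, b \in t -> (w m <= w b)%N.
  elim: t c => [|b t IH] c /=; first by [].
  have [H1 H2] := IH (if (w b < w c)%N then b else c).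
  split.
    by apply: leq_trans H1 _; case: ltnP => // /ltnW.
  move=> d; rewrite inE => /predU1P[->|/H2 //].
  by apply: leq_trans H1 _; case: ltnP.
case: s => // b s Ha; rewrite /argmin /= ltnn.
have [H1 H2] := H s b; move: Ha; rewrite inE => /predU1P[->|/H2] //.
Qed.

Definition list_load (L : seq T) g : R := (count (touch g) L)%:R.
Definition list_mult (L : seq T) g : R := (count_mem g L)%:R.
Definition load (x : T -> R) g : R := \sum_(a <- E | touch g a) x a.

Definition energy (L : seq T) : R := \sum_(g <- E) (list_load L g ^+ 2 + list_mult L g ^+ 2).

Definition score (L : seq T) e : nat := sumn [seq overlap touch E e f | f <- L].

(** This is half the partial derivative of the energy in direction [e]: expanding [A^2 + I] and
    summing over [L] first gives a sum over [g], which can be compared with the energy term by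
    term. *)
Lemma scoreE L e : e \in E ->
  (score L e)%:R = \sum_(g <- E) ((touch g e)%:R * list_load L g + (g == e)%:R * list_mult L g) :> R.
Proof.
move=> He; rewrite /score sumnE big_map natr_sum big_split /=.
transitivity (\sum_(f <- L) (\sum_(g <- E) (touch g e)%:R * (touch g f)%:R + (e == f)%:R : R)).
  apply: eq_bigr => f _; rewrite /overlap natrD; congr (_ + _).
  rewrite -sumn_count sumnE big_map natr_sum; apply: eq_bigr => g _.
  by rewrite [touch e g]touch_sym -natrM mulnb.
rewrite big_split /= exchange_big /=; congr (_ + _).
  apply: eq_bigr => g _; rewrite -mulr_sumr; congr (_ * _).
  by rewrite /list_load -sumn_count sumnE big_map natr_sum.
rewrite [RHS](bigD1_seq e) //= eqxx mul1r [X in _ + X]big1_seq ?addr0; last first.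
  by move=> g /andP[/negPf-> _]; rewrite mul0r.
rewrite /list_mult -sumn_count sumnE big_map natr_sum.
by apply: eq_bigr => f _ /=; rewrite eq_sym.
Qed.

(** A second-order expansion. The quadratic term is the energy of the single edge [e]: one for each
    edge that touches it, at most [|E|] in all, and one for [e] itself. *)
Lemma energy_cons L e : e \in E ->
  energy (e :: L) <= energy L + 2 * (score L e)%:R + (size E).+1%:R.
Proof.
move=> He; rewrite scoreE // /energy mulr_sumr -big_split /=.
have -> : (size E).+1%:R = \sum_(g <- E) (1 + (g == e)%:R) :> R.
  rewrite big_split /= big_const_seq count_predT iter_addr addr0.
  rewrite (bigD1_seq e) //= eqxx big1_seq ?addr0 ?natr1 //.
  by move=> g /andP[/negPf-> _].
rewrite -big_split /=; apply: ler_sum => g _.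
rewrite /list_load /list_mult /= !natrD.
have -> : (e == g) = (g == e) by exact: eq_sym.
by case: (touch g e); case: (g == e) => /=; lra.
Qed.

Section Comparison.
Variable x : T -> R.
Hypothesis x_ge0 : forall a, a \in E -> 0 <= x a.

Definition mass := \sum_(a <- E) x a.
Definition weighted_energy := \sum_(g <- E) (load x g ^+ 2 + x g ^+ 2).

Lemma weighted_score L :
  \sum_(e <- E) x e * (score L e)%:R =
  \sum_(g <- E) (load x g * list_load L g + x g * list_mult L g).
Proof.
under eq_big_seq => e He do rewrite scoreE // mulr_sumr.
rewrite exchange_big /=; apply: eq_big_seq => g Hg.
under eq_bigr do rewrite mulrDr; rewrite big_split /=; congr (_ + _).
  rewrite /load [in RHS]big_mkcond mulr_suml; apply: eq_bigr => e _.
  by case: (touch g e); rewrite ?mul1r // !mul0r ?mulr0.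
rewrite (bigD1_seq g) //= eqxx mul1r big1_seq ?addr0 //.
by move=> e /andP[]; rewrite eq_sym => /negPf-> _; rewrite mul0r mulr0.
Qed.

Lemma weighted_energy_ge0 : 0 <= weighted_energy.
Proof. by apply: sumr_ge0 => g _; rewrite addr_ge0 ?sqr_ge0. Qed.

Lemma mass_ge0 : 0 <= mass.
Proof. by rewrite /mass big_seq sumr_ge0. Qed.

(* The energy is a positive semidefinite form, so twice the cross term of
   [X L] and [k x] is at most the sum of their energies. *)
Lemma score_argmin L (k : nat) :
  2 * k%:R * mass ^+ 2 * (score L (argmin x0 (score L) E))%:R
    <= mass ^+ 2 * energy L + k%:R ^+ 2 * weighted_energy.
Proof.
set m := argmin _ _ _.
(* The least score is at most the average of the scores weighted by [x]. *)
have H : mass * (score L m)%:R <= \sum_(e <- E) x e * (score L e)%:R.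
  rewrite /mass mulr_suml [leLHS]big_seq [leRHS]big_seq; apply: ler_sum => e He.
  by rewrite ler_wpM2l ?x_ge0 // ler_nat argmin_le.
apply: (@le_trans _ _ (2 * k%:R * mass * \sum_(e <- E) x e * (score L e)%:R)).
  rewrite (_ : _ * _ * _ = 2 * k%:R * mass * (mass * (score L m)%:R)); last by ring.
  by rewrite ler_wpM2l // !mulr_ge0 ?ler0n ?mass_ge0.
rewrite weighted_score /energy /weighted_energy; move: mass {H} => w.
rewrite !mulr_sumr -big_split /=.
apply: ler_sum => g _.
rewrite -subr_ge0 (_ : _ - _ = (w * list_load L g - k%:R * load x g) ^+ 2 +
  (w * list_mult L g - k%:R * x g) ^+ 2); last by ring.
by rewrite addr_ge0 ?sqr_ge0.
Qed.

Definition harmonic (k : nat) : R := \sum_(j < k) j.+1%:R^-1.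

(** The first [m] terms are at most 1 and the later ones at most [1 / m]. Taking [k = m^2] gives
    [2 m], which replaces a logarithmic bound. *)
Lemma harmonic_le (k m : nat) : (0 < m)%N -> harmonic k <= (minn k m)%:R + k%:R / m%:R.
Proof.
move=> m0; have Hm : 0 < m%:R :> R by rewrite ltr0n.
elim: k => [|k IH]; first by rewrite /harmonic big_ord0 min0n mul0r addr0.
rewrite /harmonic big_ord_recr /= -/(harmonic k).
have [Hkm|Hkm] := ltnP k m.
  rewrite (minn_idPl Hkm) -natr1 mulrDl.
  move: IH; rewrite (minn_idPl (ltnW Hkm)) => IH.
  have : (k%:R + 1)^-1 <= 1 :> R by rewrite natr1 invf_le1 ?ltr0n // ler1n.
  have : 0 <= 1 / m%:R :> R by rewrite divr_ge0 ?ler01 ?ler0n.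
  by lra.
rewrite (minn_idPr (leqW Hkm)); move: IH; rewrite (minn_idPr Hkm) => IH.
have Hi : k.+1%:R^-1 <= m%:R^-1 :> R by rewrite lef_pV2 ?posrE ?ltr0n // ler_nat leqW.
by apply: le_trans (lerD IH Hi) _; rewrite -addrA -[k.+1%:R]natr1 mulrDl mul1r.
Qed.

Lemma frank_wolfeS k : E != [::] -> frank_wolfe touch x0 E k.+1 =
  argmin x0 (score (frank_wolfe touch x0 E k)) E :: frank_wolfe touch x0 E k.
Proof. by move=> HE; rewrite {1}/frank_wolfe iterS {1}/fw_step; case: nilP HE => [->|]. Qed.

Lemma mem_argmin_nonnil (w : T -> nat) s : s != [::] -> argmin x0 w s \in s.
Proof. by case: s => // a s _; apply: mem_argmin_cons. Qed.

Lemma frank_wolfe_sub k : E != [::] -> {subset frank_wolfe touch x0 E k <= E}.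
Proof.
move=> HE; elim: k => // k IH e; rewrite frank_wolfeS // inE => /predU1P[->|/IH //].
exact: mem_argmin_nonnil.
Qed.

Lemma size_frank_wolfe k : E != [::] -> size (frank_wolfe touch x0 E k) = k.
Proof. by move=> HE; elim: k => // k IH; rewrite frank_wolfeS //= IH. Qed.

(** Inserting [score_argmin] into [energy_cons] and dividing by [k.+1] yields a recursion for
    [energy / k] whose error grows by [(|E| + 1) / k.+1] in each round; hence the harmonic sum.
    Everything is multiplied out, as the mass may be 0. *)
Lemma frank_wolfe_energy k : E != [::] ->
  mass ^+ 2 * energy (frank_wolfe touch x0 E k) <=
  k%:R ^+ 2 * weighted_energy + mass ^+ 2 * ((size E).+1%:R * k%:R * harmonic k).
Proof.
move=> HE; elim: k => [|k IH].
  rewrite /energy big1 ?mulr0 ?mul0r ?expr0n ?mulr0 ?mul0r ?addr0 //.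
  by move=> g _; rewrite /list_load /list_mult /= expr0n addr0.
set L := frank_wolfe touch x0 E k in IH.
rewrite frank_wolfeS // -/L; set e := argmin _ _ _.
have He : e \in E by exact: mem_argmin_nonnil.
have Hc := energy_cons L He.
have Hs := score_argmin L k; rewrite -/e in Hs.
rewrite /harmonic big_ord_recr /= -/(harmonic k).
set N := (size E).+1%:R in Hc IH *; set H := harmonic k in IH *.
set s := (score L e)%:R in Hc Hs.
have m2 : 0 <= mass ^+ 2 := sqr_ge0 _.
have Q0 := weighted_energy_ge0; set Q := weighted_energy in Q0 IH Hs *.
have Hc' : mass ^+ 2 * energy (e :: L) <= mass ^+ 2 * energy L + 2 * mass ^+ 2 * s + mass ^+ 2 * N.
  have := ler_wpM2l m2 Hc; rewrite !mulrDr; lra.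
apply: le_trans Hc' _.
set W := mass ^+ 2 in IH Hs m2 *; set q := energy L in IH Hs *.
(* The general step multiplies through by [k], so the first round is treated apart. *)
have [k0|k0] := posnP k.
  have L0 : L = [::] by rewrite /L k0.
  have -> : q = 0.
    rewrite /q L0 /energy big1 // => g _.
    by rewrite /list_load /list_mult /= expr0n addr0.
  have -> : s = 0 by rewrite /s L0.
  have -> : H = 0 by rewrite /H k0 /harmonic big_ord0.
  by rewrite k0 (_ : 1%:R = 1) // !mulr0 !add0r invr1 !mulr1 expr1n mul1r; lra.
have Hk : 0 < k%:R :> R by rewrite ltr0n.
have Hk1 : k.+1%:R = k%:R + 1 :> R by rewrite natr1.
have -> : N * k.+1%:R * (H + k.+1%:R^-1) = N * k.+1%:R * H + N.
  by rewrite mulrDr -mulrA -[in X in _ + X]mulrA divff ?mulr1 ?pnatr_eq0 // mulrA.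
rewrite Hk1 -(ler_pM2l Hk); set z := k%:R in IH Hs Hk *.
have IH' : (z + 1) * (W * q) <= (z + 1) * (z ^+ 2 * Q + W * (N * z * H)).
  by rewrite ler_wpM2l // addr_ge0 // ltW.
have HzQ : 0 <= z * Q by rewrite mulr_ge0 // ltW.
lra.
Qed.

End Comparison.
End FrankWolfe.

(** * Rounding and local search *)

Section Independence.
Local Open Scope nat_scope.
Variables (T : eqType) (touch : rel T) (x0 : T) (E : seq T).
Hypotheses (touch_sym : symmetric touch) (touch_refl : reflexive touch).
Implicit Types (L M c : seq T).

Local Notation conf := (conflict touch E).
Local Notation unblocked := (unblocked touch E).

Definition independent M :=
  [/\ uniq M, {subset M <= E} & {in M &, forall a b, a != b -> ~~ conf a b}].

Lemma conflict_sym a b : conf a b = conf b a.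
Proof. by apply: eq_has => g; rewrite andbC ![touch g _]touch_sym ![touch _ g]touch_sym. Qed.

Lemma conflictxx a : a \in E -> conf a a.
Proof. by move=> Ha; apply/hasP; exists a; rewrite ?touch_refl. Qed.

Lemma independent_cat c M : independent c -> independent M ->
  independent (c ++ unblocked M c).
Proof.
move=> [uc sc ic] [uM sM iM]; split.
- rewrite cat_uniq uc filter_uniq // andbT /=.
  apply/hasPn => b; rewrite mem_filter => /andP[Hb HbM]; apply: contra Hb => Hbc.
  by apply/hasP; exists b => //; apply/conflictxx/sc.
- move=> a; rewrite mem_cat mem_filter => /orP[/sc //|/andP[_ /sM //]].
have H a b : a \in c -> b \in unblocked M c -> ~~ conf a b.
  rewrite mem_filter conflict_sym => Ha /andP[Hb _]; apply: contra Hb => Hb.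
  by apply/hasP; exists a.
move=> a b; rewrite !mem_cat => /orP[Ha|Ha] /orP[Hb|Hb] nab.
- exact: ic.
- exact: H.
- by rewrite conflict_sym H.
by move: Ha Hb; rewrite !mem_filter => /andP[_ Ha] /andP[_ Hb]; apply: iM.
Qed.

Lemma independent_seq1 a : a \in E -> independent [:: a].
Proof.
move=> Ha; split=> // [b|b d]; first by rewrite inE => /eqP->.
by rewrite !inE => /eqP-> /eqP->; rewrite eqxx.
Qed.

Lemma independent_candidate f g : f \in E -> g \in E -> independent (candidate touch E f g).
Proof.
move=> Hf Hg; rewrite /candidate; case: ifP => Hfg; first exact: independent_seq1.
have nfg : f != g by apply: contraFN Hfg => /eqP->; apply: conflictxx.
split=> [|b|b d]; first by rewrite /= inE nfg.
  by rewrite !inE => /orP[] /eqP->.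
rewrite !inE => /orP[] /eqP-> /orP[] /eqP->; rewrite ?eqxx // => _.
  by rewrite Hfg.
by rewrite conflict_sym Hfg.
Qed.

Section Rounding.
Variable L : seq T.
Hypothesis sLE : {subset L <= E}.

Local Notation pick := (pick_step touch x0 E L).

Definition pairs_in (s : seq T) : nat := \sum_(a <- s) count (conf a) s.

Lemma pick_unblocked M : unblocked L M != [::] ->
  exists a, [/\ pick M = a :: M, a \in unblocked L M &
    forall b, b \in unblocked L M -> count (conf a) (unblocked L M) <= count (conf b) (unblocked L M)].
Proof.
move=> HF; rewrite /pick_step; case: nilP HF => [->|_ HF] //.
exists (argmin x0 (fun a => count (conf a) (unblocked L M)) (unblocked L M)).
split=> [||b Hb] //; first exact: (mem_argmin_nonnil x0 _ HF).
exact: (argmin_le x0 (fun a => count (conf a) (unblocked L M)) Hb).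
Qed.

Lemma pick_independent M : independent M -> independent (pick M).
Proof.
move=> iM; have [F0|/pick_unblocked[a [-> Ha _]]] := eqVneq (unblocked L M) [::].
  by rewrite /pick_step F0.
move: Ha; rewrite mem_filter => /andP[nHa /sLE Ha].
(* An unblocked [a] conflicts with nothing in [M]: picking it is an exchange that deletes
   nothing. *)
have E1 : unblocked M [:: a] = M.
  apply/all_filterP/allP => b Hb /=; rewrite orbF; apply: contra nHa => Hba.
  by apply/hasP; exists b => //; rewrite conflict_sym.
by have := independent_cat (independent_seq1 Ha) iM; rewrite E1.
Qed.

(* Each pick removes [m] elements of the current list, all of conflict degree
   at least [m]; Cauchy-Schwarz then bounds the number of picks from below. *)
Lemma pick_energy n M : size (unblocked L M) <= n ->
  exists2 j, size (iter n pick M) = j + size M &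
    size (unblocked L M) ^ 2 <= j * pairs_in (unblocked L M).
Proof.
elim: n M => [|n IH] M.
  by rewrite leqn0 => /nilP->; exists 0.
have [F0 _|F0 Hn] := eqVneq (unblocked L M) [::].
  exists 0; rewrite ?F0 //; have EM : pick M = M by rewrite /pick_step F0.
  suff -> : iter n.+1 pick M = M by [].
  by elim: n.+1 => //= k ->.
have [a [Epick Ha Hmin]] := pick_unblocked F0.
rewrite iterSr Epick.
set cur := unblocked L M in F0 Hn Ha Hmin *.
have Ecur : unblocked L (a :: M) = [seq b <- cur | ~~ conf b a].
  rewrite /cur -filter_predI; apply: eq_filter => b /=.
  by rewrite negb_or.
set m := count (conf a) cur in Hmin.
have Em : size [seq b <- cur | conf b a] = m.
  by rewrite size_filter; apply: eq_count => b; rewrite conflict_sym.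
have m_gt0 : 0 < m.
  rewrite -has_count; apply/hasP; exists a => //; apply/conflictxx/sLE.
  by move: Ha; rewrite mem_filter => /andP[].
have Hsz : m + size (unblocked L (a :: M)) = size cur.
  by rewrite Ecur -Em -[RHS](count_predC (fun b => conf b a)) !size_filter.
have [|j Hj HS] := IH (a :: M); first by lia.
exists j.+1; first by rewrite Hj /= addSnnS.
(* Each of the [m] elements in conflict with [a] lies in at least [m] pairs, by the choice of [a];
   the pairs among the others are those of the next list. *)
have HS2 : m * m + pairs_in (unblocked L (a :: M)) <= pairs_in cur.
  rewrite /pairs_in [in leqRHS](bigID (fun b => conf b a)) /= leq_add //.
    rewrite -big_filter -{1}Em -sum1_size big_distrl /=.
    rewrite big_seq [leqRHS]big_seq; apply: leq_sum => b.
    by rewrite mem_filter => /andP[_ Hb]; rewrite mul1n Hmin.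
  rewrite Ecur big_filter; apply: leq_sum => b _.
  by rewrite count_filter; apply: sub_count => d /= /andP[].
apply: leq_trans (leq_mul (leqnn _) HS2); rewrite -Hsz.
move: (size _) (pairs_in _) HS => c' S; clear; rewrite -!mulnn => HS.
(* For [j > 0]: [2 (j m) c' <= (j m)^2 + c'^2 <= j (j m^2 + S)], and a factor [j] cancels. For
   [j = 0] the remaining list is empty. *)
suff H : 2 * (m * c') <= j * (m * m) + S by move: H HS; clear; nia.
case: j HS => [|j] HS; first by move: HS; case: c' => [|c']; rewrite ?muln0 // mul0n.
rewrite -(leq_pmul2l (ltn0Sn j)); have := nat_Cauchy (j.+1 * m) c'.
rewrite -!mulnn; move: (j.+1) HS; clear=> i HS HC.
have -> : i * (2 * (m * c')) = 2 * (i * m * c') by ring.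
have -> : i * (i * (m * m) + S) = i * m * (i * m) + i * S by ring.
by apply: leq_trans HC _; rewrite leq_add2l.
Qed.

Lemma rounding_independent : independent (rounding touch x0 E L).
Proof.
by rewrite /rounding; elim: (size L) => //= k IH; apply: pick_independent.
Qed.

Lemma rounding_energy :
  size L ^ 2 <= size (rounding touch x0 E L) * pairs_in L.
Proof.
have F : unblocked L [::] = L by apply/all_filterP/allP.
have [|j] := @pick_energy (size L) [::]; first by rewrite F.
by rewrite F addn0 /rounding => ->.
Qed.

End Rounding.

Section LocalSearch.

Lemma swap_independent M f g : f \in E -> g \in E -> independent M -> independent (swap touch E M f g).
Proof.
move=> Hf Hg iM; rewrite /swap; case: ifP => // _.
by apply: independent_cat => //; apply: independent_candidate.
Qed.

Lemma swap_size_le M f g : size M <= size (swap touch E M f g).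
Proof. by rewrite /swap; case: ifP => // /ltnW. Qed.

Lemma swap_eq_size M f g : size (swap touch E M f g) <= size M ->
  size (exchange touch E M (candidate touch E f g)) <= size M.
Proof. by rewrite /swap; case: ltnP => // H1 H2; move: (leq_trans H1 H2); rewrite ltnn. Qed.

Lemma swaps_ind (P : seq T -> Prop) (s t : seq T) M :
  {subset s <= E} -> {subset t <= E} ->
  (forall M f g, f \in E -> g \in E -> P M -> P (swap touch E M f g)) -> P M ->
  P (foldl (fun M f => foldl (fun M g => swap touch E M f g) M t) M s).
Proof.
move=> Hs Ht HP; elim: s M Hs => //= f s IH M Hs PM.
apply: IH => [a Ha|]; first by rewrite Hs // inE Ha orbT.
have Hf : f \in E by rewrite Hs ?mem_head.
elim: t M Ht PM => //= g t IH M Ht PM; apply: IH => [a Ha|].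
  by rewrite Ht // inE Ha orbT.
by apply: HP => //; rewrite Ht ?mem_head.
Qed.

Lemma swaps_independent M : independent M -> independent (swaps touch E M).
Proof. by apply: swaps_ind => // M' f g; apply: swap_independent. Qed.

Definition swap_optimal M :=
  forall f g, f \in E -> g \in E -> size (exchange touch E M (candidate touch E f g)) <= size M.

Lemma row_size_le M f t : size M <= size (foldl (fun M g => swap touch E M f g) M t).
Proof.
by elim: t M => //= g t IH M; apply: leq_trans (IH _); apply: swap_size_le.
Qed.

Lemma swap_stable M f g : size (swap touch E M f g) <= size M -> swap touch E M f g = M.
Proof. by rewrite /swap; case: ltnP => // H1 H2; move: (leq_trans H1 H2); rewrite ltnn. Qed.

(** Sizes never drop along a sweep, so a sweep without net gain accepts no swap at all; every
    candidate was then tested against the same [M]. *)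
Lemma swaps_stable M : size (swaps touch E M) <= size M ->
  swap_optimal M /\ swaps touch E M = M.
Proof.
have row f t : size (foldl (fun M g => swap touch E M f g) M t) <= size M ->
    (forall g, g \in t -> size (exchange touch E M (candidate touch E f g)) <= size M) /\
    foldl (fun M g => swap touch E M f g) M t = M.
  elim: t => //= g t IH H.
  have H1 : size (swap touch E M f g) <= size M.
    by apply: leq_trans H; apply: row_size_le.
  rewrite (swap_stable H1) in H *; have [H2 H3] := IH H; split=> // h.
  by rewrite inE => /predU1P[->|/H2 //]; apply: swap_eq_size.
have rows_le N s : size N <=
    size (foldl (fun M f => foldl (fun M g => swap touch E M f g) M E) N s).
  by elim: s N => //= f s IH N; apply: leq_trans (IH _); apply: row_size_le.
suff H s : size (foldl (fun M f => foldl (fun M g => swap touch E M f g) M E) M s) <= size M ->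
    (forall f g, f \in s -> g \in E -> size (exchange touch E M (candidate touch E f g)) <= size M) /\
    foldl (fun M f => foldl (fun M g => swap touch E M f g) M E) M s = M.
  by move=> /H[H1 H2].
elim: s => //= f s IH H.
have [H1 H2] := row f E (leq_trans (rows_le _ _) H).
rewrite H2 in H *; have [H3 H4] := IH H; split=> // f' g.
by rewrite inE => /predU1P[->|Hf] Hg; [apply: H1 | apply: H3].
Qed.

Lemma size_swaps_le M : size M <= size (swaps touch E M).
Proof.
apply: (@swaps_ind (fun N => size M <= size N)) => // N f g _ _ H.
exact: leq_trans H (swap_size_le _ _ _).
Qed.

(** As long as the set changes, each sweep gains at least one edge. After [|E| + 1] gaining sweeps
    there would be more than [|E|] distinct edges of [E], so a fixed point has been reached. *)
Lemma local_searchP M : independent M ->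
  [/\ independent (local_search touch E M), size M <= size (local_search touch E M)
    & swap_optimal (local_search touch E M)].
Proof.
move=> iM; pose it k := iter k (swaps touch E) M.
have Hi k : independent (it k) by elim: k => //= k; apply: swaps_independent.
have Hk k : k <= size (it k) \/ swaps touch E (it k) = it k.
  elim: k => [|k [IH|IH]]; [by left | | by right; rewrite /= IH].
  have [H|H] := leqP (size (swaps touch E (it k))) (size (it k)).
    by right; have [_ H2] := swaps_stable H; rewrite /= !H2.
  by left; apply: leq_ltn_trans IH _.
split; first exact: (Hi (size E).+1).
  rewrite /local_search; elim: (size E).+1 => //= k IH.
  exact: leq_trans IH (size_swaps_le _).
suff H : size (swaps touch E (it (size E).+1)) <= size (it (size E).+1).
  by have [] := swaps_stable H.
have [H|-> //] := Hk (size E).+1.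
have [u s _] := Hi (size E).+1.
by have := uniq_leq_size u s; rewrite leqNgt H.
Qed.

End LocalSearch.
End Independence.

(** * Strong cliques *)

Section StrongClique.
Local Open Scope nat_scope.
Variables (V : finType) (G : sgraph V) (Delta : nat).
Hypothesis deg_le : forall u, degree G u <= Delta.

Definition near (r s : V) : bool := (r == s) || G r s.

Variable P : rel V.
Hypotheses (P_sym : symmetric P) (P_sub : subrel P G).
Hypothesis P_clique : forall x y x' y', P x y -> P x' y' ->
  [|| near x x', near x y', near y x' | near y y'].

Let a x := \sum_y P x y.

Lemma degreeE u : degree G u = \sum_v G u v.
Proof. by rewrite /degree -sum1_card big_mkcond; apply: eq_bigr => v _; rewrite inE; case: (G u v). Qed.

Section Extremal.
Variable z : V.
Hypothesis z_max : forall x, a x <= a z.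
Hypothesis z_pos : 0 < a z.
Let beta := a z.
(** Call a clique edge far if both of its ends lie outside the neighbourhood of [z]. A far edge [xy]
    has to be linked to every clique edge [zt]; [sP] and [sN] separate the links [tx] that belong to
    the clique from those that do not. The sum [r] counts every far edge twice. *)
Let aR x := \sum_(y | ~~ G z y) P x y.
Let sP x := \sum_(t | P z t) P x t.
Let sN x := \sum_(t | P z t) (G t x && ~~ P t x).
Let r := \sum_(x | ~~ G z x) aR x.

(** Clique neighbours of [z] are neighbours of [z], so the two terms count disjoint sets of clique
    edges at [x]. *)
Lemma degree_split x : aR x + sP x <= beta.
Proof.
apply: leq_trans (z_max x).
rewrite /a [leqRHS](bigID (fun y => G z y)) /= addnC leq_add2r /sP.
rewrite [leqLHS]big_mkcond [leqRHS]big_mkcond; apply: leq_sum => t _.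
by case: ifP => // /P_sub ->.
Qed.

(** Neither end of [xy] is near [z] or equal to [t], so each of the [beta] clique edges [zt] is
    linked to [xy] by an edge from [t] to [x] or to [y]. *)
Lemma far_edge x y : ~~ G z x -> ~~ G z y -> P x y ->
  beta <= (sP x + sN x) + (sP y + sN y).
Proof.
move=> Gx Gy Pxy; rewrite /sP /sN -!big_split /= /beta /a.
rewrite (eq_bigr (fun t => if P z t then 1 else 0)) => [|t _]; last by case: (P z t).
rewrite -big_mkcond; apply: leq_sum => t Pzt.
have zx : z != x by apply: contraNneq Gy => ->; apply: P_sub.
have zy : z != y by apply: contraNneq Gx => ->; apply: P_sub; rewrite P_sym.
have tx : t != x by apply: contraNneq Gx => <-; apply: P_sub.
have ty : t != y by apply: contraNneq Gy => <-; apply: P_sub.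
have := P_clique Pzt Pxy.
rewrite /near (negPf zx) (negPf zy) (negPf tx) (negPf ty) (negPf Gx) (negPf Gy) /=.
by rewrite [P x t]P_sym [P y t]P_sym; case/orP=> ->; case: (P t x); case: (P t y) => //=; lia.
Qed.

(* The tangent at [s = beta / 3] of the convex function [s / (beta - s)], which
   bounds [sP x / aR x] from below. *)
Lemma tangent x : 9 * (aR x * sP x) <= 4 * (beta * sP x) + beta * aR x.
Proof.
have := degree_split x; move: (aR x) (sP x) beta => u s b Hus.
have [H|H] := leqP (9 * s) b.
  rewrite mulnCA; apply: leq_trans (leq_addl _ _).
  by rewrite [b * u]mulnC leq_mul2l H orbT.
(* Now the coefficient [9 s - b] of [u] is positive, so [u] may be raised to [e = b - s]; the claim
   becomes [(2 s - e)^2 >= 0]. *)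
have [e Eb] : exists e, b = s + e by exists (b - s); lia.
have [d Ed] : exists d, 9 * s = b + d by exists (9 * s - b); lia.
have Hu : u * d <= e * d by rewrite leq_mul2r; apply/orP; right; lia.
have Ed2 : e * d + e * e = 8 * (e * s).
  by rewrite -mulnDr (_ : d + e = 8 * s); [ring | lia].
have HC : 4 * (s * e) <= 4 * (s * s) + e * e.
  have E1 : 4 * (s * e) = 2 * (2 * s * e) by ring.
  have E2 : 4 * (s * s) + e * e = (2 * s) ^ 2 + e ^ 2 by rewrite -!mulnn; ring.
  by rewrite E1 E2; apply: nat_Cauchy.
rewrite mulnCA Ed mulnDr [u * b]mulnC addnC leq_add2r; apply: leq_trans Hu _.
rewrite Eb mulnDl mulnDr; move: Ed2 HC; rewrite ![e * s]mulnC.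
by move: (e * d) (e * e) (s * e) (s * s); clear; lia.
Qed.

(** Summing [far_edge] over the far edges gives [beta r] at most twice the sum of [aR (sP + sN)].
    The part with [sP] is bounded by [tangent], which returns a term [2/9 beta r], and the part with
    [sN] by [aR <= beta]. Collecting terms and cancelling [beta] leaves 7, 8 and 18. *)
Lemma far_edges : 7 * r <= 8 * (\sum_(x | ~~ G z x) sP x) + 18 * (\sum_(x | ~~ G z x) sN x).
Proof.
have H1 : beta * r <= 2 * \sum_(x | ~~ G z x) aR x * (sP x + sN x).
  have H2 : \sum_(x | ~~ G z x) \sum_(y | ~~ G z y) P x y * (sP y + sN y) =
      \sum_(x | ~~ G z x) aR x * (sP x + sN x).
    rewrite exchange_big /=; apply: eq_bigr => x _.
    by rewrite -big_distrl /=; congr (_ * _); apply: eq_bigr => y _; rewrite P_sym.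
  have H3 : \sum_(x | ~~ G z x) \sum_(y | ~~ G z y) P x y * (sP x + sN x) =
      \sum_(x | ~~ G z x) aR x * (sP x + sN x).
    by apply: eq_bigr => x _; rewrite -big_distrl.
  rewrite mul2n -addnn -{1}H3 -H2 -big_split /r big_distrr /=.
  apply: leq_sum => x Gx; rewrite -big_split /aR big_distrr /=.
  apply: leq_sum => y Gy; rewrite -mulnDr.
  case Pxy: (P x y) => //=; last by rewrite muln0.
  by rewrite muln1 mul1n; apply: far_edge.
have H2 : 9 * (\sum_(x | ~~ G z x) aR x * sP x) <=
    4 * (beta * \sum_(x | ~~ G z x) sP x) + beta * r.
  rewrite !big_distrr /= -big_split /=; apply: leq_sum => x _; exact: tangent.
have H3 : \sum_(x | ~~ G z x) aR x * sN x <= beta * \sum_(x | ~~ G z x) sN x.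
  rewrite big_distrr /=; apply: leq_sum => x _; rewrite leq_mul2r; apply/orP; right.
  by apply: leq_trans (degree_split x); apply: leq_addr.
have beta_gt0 : 0 < beta by [].
rewrite -(leq_pmul2l beta_gt0).
have H4 : \sum_(x | ~~ G z x) aR x * (sP x + sN x) =
   \sum_(x | ~~ G z x) aR x * sP x + \sum_(x | ~~ G z x) aR x * sN x.
  by rewrite -big_split; apply: eq_bigr => x _; rewrite mulnDr.
rewrite H4 in H1; rewrite mulnDr (mulnCA beta 7) (mulnCA beta 8) (mulnCA beta 18).
move: H1 H2 H3.
move: (\sum_(x | _) aR x * sP x) (\sum_(x | _) aR x * sN x)
  (\sum_(x | _) sP x) (\sum_(x | _) sN x) => A1 A2 A3 A4.
move: (beta * r) (beta * A3) (beta * A4); clear; lia.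
Qed.

(** An edge that is not far has an end in the neighbourhood of [z], which costs [14 pS + 14 k beta]
    besides [7 r]. With [far_edges] the coefficient of [pS] is [8 + 14 = 22] and that of the sum of
    [sN] is 18, so [pS] plus that sum is needed only up to [beta Delta]; finally
    [beta + k <= Delta]. The left side counts each clique edge twice, whence [11/7]. *)
Lemma clique_degree_sum : 7 * (\sum_x a x) <= 22 * (Delta * Delta).
Proof.
pose pS := \sum_(t | P z t) a t; pose k := \sum_y (G z y && ~~ P z y).
have Hk : beta + k <= Delta.
  apply: leq_trans (deg_le z); rewrite degreeE /beta /a /k -big_split /=.
  apply: leq_sum => t _; case Pzt: (P z t); last by rewrite andbT.
  by rewrite (P_sub Pzt).
have HbD : beta <= Delta by apply: leq_trans Hk; apply: leq_addr.
have HN : \sum_(t | G z t) a t <= pS + k * beta.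
  rewrite (bigID (fun t => P z t)) /= leq_add //.
    rewrite /pS [leqLHS]big_mkcond [leqRHS]big_mkcond; apply: leq_sum => t _.
    by case: (P z t); rewrite ?andbF // andbT; case: ifP.
  rewrite /k big_distrl /= big_mkcond; apply: leq_sum => t _.
  by case: ifP => // _; rewrite mul1n z_max.
have HA : \sum_x a x <= r + 2 * \sum_(t | G z t) a t.
  rewrite (bigID (fun x => G z x)) /= addnC mul2n -addnn addnA leq_add2r.
  have -> : \sum_(t | G z t) a t = \sum_x \sum_(y | G z y) P x y.
    by rewrite exchange_big /=; apply: eq_bigr => t _; apply: eq_bigr => x _; rewrite P_sym.
  apply: (@leq_trans (r + \sum_(x | ~~ G z x) \sum_(y | G z y) P x y)).
    rewrite /r -big_split; apply: leq_sum => x _.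
    by rewrite /a (bigID (fun y => G z y)) /= addnC.
  by rewrite leq_add2l [leqRHS](bigID (fun x => G z x)) /= leq_addl.
have HS : pS + \sum_x sN x <= beta * Delta.
  rewrite /sN exchange_big /= -big_split /= /beta /a big_distrl /=.
  rewrite [leqRHS](eq_bigr (fun t => if P z t then Delta else 0)); last first.
    by move=> t _; case: (P z t); rewrite ?mul1n.
  rewrite -big_mkcond; apply: leq_sum => t _.
  apply: leq_trans (deg_le t); rewrite degreeE /a -big_split /=.
  apply: leq_sum => x _; case Ptx: (P t x); last by rewrite andbT.
  by rewrite (P_sub Ptx).
have HsP : \sum_(x | ~~ G z x) sP x <= pS.
  rewrite /pS /sP exchange_big /=; apply: leq_sum => t _.
  rewrite /a [leqRHS](bigID (fun x => G z x)) /=; apply: leq_trans (leq_addl _ _).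
  by apply: leq_sum => x _; rewrite P_sym.
have HsN : \sum_(x | ~~ G z x) sN x <= \sum_x sN x.
  by rewrite [leqRHS](bigID (fun x => G z x)) /= leq_addl.
have := far_edges.
move: (\sum_(x | _) sP x) (\sum_(x | _) sN x) (\sum_x sN x) (\sum_(t | G z t) a t)
  (\sum_x a x) HsP HsN HS HA HN => A1 A2 A3 A4 A5 HsP HsN HS HA HN HF.
have H1 : 7 * A5 <= 22 * (beta * Delta) + 14 * (k * beta) by lia.
apply: leq_trans H1 _.
have H2 : k * beta <= k * Delta by rewrite leq_mul2l HbD orbT.
have H3 : (beta + k) * Delta <= Delta * Delta by rewrite leq_mul2r Hk orbT.
by rewrite mulnDl in H3; lia.
Qed.

End Extremal.

Lemma strong_clique_bound : 7 * (\sum_x \sum_y P x y) <= 22 * (Delta * Delta).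
Proof.
have [x _|V0] := pickP V; last by rewrite big1 ?muln0 // => x; have := V0 x.
have [z _ zmax] := arg_maxnP a (erefl : xpredT x).
have [Hz|z0] := posnP (a z).
  rewrite big1 ?muln0 // => y _; apply/eqP; rewrite -leqn0.
  by apply: leq_trans (zmax y isT) _; rewrite Hz.
by apply: (clique_degree_sum (z := z)) => // y; apply: (zmax y).
Qed.

End StrongClique.

(** * Conflicts in a graph *)

Section EdgeList.
Variables (V : finType) (G : sgraph V) (E : seq (V * V)).

Definition orientation : Prop :=
  [/\ uniq E, forall u v, G u v = ((u, v) \in E) || ((v, u) \in E)
    & forall u v, (u, v) \in E -> (v, u) \notin E].

Hypothesis HE : orientation.

Lemma orientation_adj e : e \in E -> G e.1 e.2.
Proof. by case: HE => _ H _; case: e => u v Huv; rewrite H Huv. Qed.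

Lemma orientation_neq e : e \in E -> e.1 != e.2.
Proof. by move=> /orientation_adj; case: eqP => // ->; rewrite adj_irr. Qed.

Lemma big_orientation (R : Type) (idx : R) (op : Monoid.com_law idx) (F : V -> V -> R) :
  \big[op/idx]_(e <- E) op (F e.1 e.2) (F e.2 e.1) =
  \big[op/idx]_u \big[op/idx]_(v | G u v) F u v.
Proof.
case: HE => E_uniq E_adj E_asym.
rewrite [RHS]pair_big_dep /= [RHS](bigID (fun p => p \in E)) /= [LHS]big_split /=; congr (op _ _).
  rewrite big_uniq //=; apply: eq_bigl => -[u v] /=.
  by rewrite E_adj; case: (_ \in E); rewrite ?andbF.
rewrite big_uniq //= (reindex_inj (h := fun p : V * V => (p.2, p.1))) /=; last first.
  by move=> [u v] [u' v'] [-> ->].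
apply: eq_bigl => -[u v] /=.
rewrite E_adj; case Huv: ((v, u) \in E); first by rewrite orbT (E_asym _ _ Huv).
by rewrite orbF andbN.
Qed.

Local Open Scope nat_scope.

Local Notation conf := (conflict share E).

Lemma share_sym : symmetric (@share V).
Proof.
move=> a b; rewrite /share ![b.1 == _]eq_sym ![b.2 == _]eq_sym.
by case: (a.1 == b.1); case: (a.1 == b.2); case: (a.2 == b.1).
Qed.

Lemma share_refl : reflexive (@share V).
Proof. by move=> a; rewrite /share eqxx. Qed.

Lemma conflictP a b : a \in E -> b \in E ->
  conf a b = [|| near G a.1 b.1, near G a.1 b.2, near G a.2 b.1 | near G a.2 b.2].
Proof.
case: HE => E_uniq E_adj E_asym Ha Hb; apply/idP/idP.
  case/hasP=> -[u v] Hg; have Guv := orientation_adj Hg; rewrite /= in Guv.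
  have Gvu : G v u by rewrite adj_sym.
  rewrite /share /near /=.
  by case/andP=> /or4P[] /eqP-> /or4P[] /eqP <-; rewrite ?eqxx ?Guv ?Gvu ?orbT.
have mid u v : near G u v -> [|| a.1 == u | a.2 == u] -> [|| b.1 == v | b.2 == v] -> conf a b.
  rewrite /near => /orP[/eqP<- Hu Hv|].
    apply/hasP; exists a => //; rewrite share_refl /= /share.
    by case/orP: Hu => /eqP->; case/orP: Hv => /eqP->; rewrite eqxx ?orbT.
  rewrite E_adj => /orP[] Huv Hu Hv; apply/hasP; [exists (u, v)|exists (v, u)] => //;
    by rewrite /share /=; case/orP: Hu => /eqP->; case/orP: Hv => /eqP->; rewrite !eqxx ?orbT.
by case/or4P=> /mid; apply; rewrite eqxx ?orbT.
Qed.

Variable Delta : nat.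
Hypothesis deg_le : forall u, degree G u <= Delta.

Lemma count_incident w : count (fun f => (f.1 == w) || (f.2 == w)) E = degree G w.
Proof.
have H := big_orientation addn (fun u _ => nat_of_bool (u == w)).
transitivity (\sum_(e <- E) ((e.1 == w) + (e.2 == w))).
  rewrite -sumn_count sumnE big_map; apply: eq_big_seq => e /orientation_neq.
  by case: (e.1 =P w) => [->|_] //=; rewrite eq_sym => /negPf->.
rewrite H (bigD1 w) //= [X in _ + X]big1 ?addn0; last first.
  by move=> u /negPf Hu; rewrite big1 // => v _; rewrite Hu.
by rewrite eqxx degreeE [RHS]big_mkcond /=; rewrite big_mkcond; apply: eq_bigr => v _; case: (G w v).
Qed.

(** An edge that meets [e] at one end is incident with a neighbour of the other end. So every edge
    in conflict with [e] is incident with a neighbour of [e.1] or of [e.2], and each end accounts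
    for at most [Delta^2] edges. *)
Lemma count_conflict e : e \in E -> count (conf e) E <= 2 * (Delta * Delta).
Proof.
move=> He; have Gu := orientation_adj He.
pose inc w (f : V * V) := (f.1 == w) || (f.2 == w).
have H u : \sum_(w | G u w) count (inc w) E <= Delta * Delta.
  apply: (@leq_trans (\sum_(w | G u w) Delta)).
    by apply: leq_sum => w _; rewrite count_incident.
  rewrite sum_nat_const leq_mul2r; apply/orP; right.
  by rewrite -[X in X <= _](_ : degree G u = _) // /degree cardsE.
rewrite mul2n -addnn.
apply: leq_trans (leq_add (H e.1) (H e.2)).
under eq_bigr do rewrite -sumn_count sumnE big_map.
under [X in _ + X]eq_bigr do rewrite -sumn_count sumnE big_map.
rewrite exchange_big [X in _ + X]exchange_big -big_split /=.
rewrite -sumn_count sumnE big_map big_seq [leqRHS]big_seq; apply: leq_sum => f Hf.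
case Hc: (conf e f) => //; rewrite conflictP // in Hc.
have low u w : G u w -> inc w f -> 0 < \sum_(i | G u i) inc i f.
  by move=> Guw Hw; rewrite (bigD1 w) //= Hw.
have nbr u v : G u v -> near G u f.1 || near G u f.2 ->
    0 < \sum_(i | G u i) inc i f \/ 0 < \sum_(i | G v i) inc i f.
  move=> Guv; rewrite /near => /orP[] /orP[/eqP Hu|Hu].
  - by right; apply: (low _ u); rewrite /inc ?Hu ?eqxx // -Hu adj_sym.
  - by left; apply: (low _ f.1) => //; rewrite /inc eqxx.
  - by right; apply: (low _ u); rewrite /inc ?Hu ?eqxx ?orbT // -Hu adj_sym.
  - by left; apply: (low _ f.2) => //; rewrite /inc eqxx orbT.
rewrite addn_gt0; case/or4P: Hc => Hc.
- by have [->|->] := nbr _ _ Gu (introT orP (or_introl Hc)); rewrite ?orbT.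
- by have [->|->] := nbr _ _ Gu (introT orP (or_intror Hc)); rewrite ?orbT.
- rewrite adj_sym in Gu.
  by have [->|->] := nbr _ _ Gu (introT orP (or_introl Hc)); rewrite ?orbT.
rewrite adj_sym in Gu.
by have [->|->] := nbr _ _ Gu (introT orP (or_intror Hc)); rewrite ?orbT.
Qed.

Lemma clique_count (K : seq (V * V)) : uniq K -> {subset K <= E} ->
  {in K &, forall a b, conf a b} -> 7 * size K <= 11 * (Delta * Delta).
Proof.
move=> K_uniq sKE K_conf; case: HE => E_uniq E_adj E_asym.
pose P u v := ((u, v) \in K) || ((v, u) \in K).
have P_sym : symmetric P by move=> u v; rewrite /P orbC.
have P_sub : subrel P G.
  by move=> u v; rewrite E_adj => /orP[] /sKE ->; rewrite ?orbT.
have P_clique x y x' y' : P x y -> P x' y' ->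
    [|| near G x x', near G x y', near G y x' | near G y y'].
  rewrite /P => H1 H2.
  case/orP: H1 => H1; case/orP: H2 => H2; have := K_conf _ _ H1 H2;
  rewrite conflictP ?sKE //=; do 4!case: (near _ _ _) => //.
have := strong_clique_bound deg_le P_sym P_sub P_clique.
have -> : \sum_x \sum_y P x y = 2 * size K.
  transitivity (\sum_x \sum_(y | G x y) P x y).
    apply: eq_bigr => x _; rewrite [RHS]big_mkcond; apply: eq_bigr => y _.
    by case: ifP => // nG; case Pxy: (P x y) => //; rewrite P_sub in nG.
  rewrite -(big_orientation addn (fun u v => nat_of_bool (P u v))) /=.
  under eq_bigr do rewrite P_sym addnn -mul2n.
  rewrite -big_distrr /=; congr (2 * _).
  transitivity (\sum_(e <- E) (e \in K)).
    apply: eq_big_seq => -[u v] /= He; rewrite /P orbC.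
    by case Hvu: ((u, v) \in K) => //=; case Huv: ((v, u) \in K) => //; move: (E_asym _ _ He); rewrite sKE.
  transitivity (size [seq e <- E | e \in K]).
    by rewrite size_filter -sumn_count sumnE big_map.
  apply: perm_size; apply: uniq_perm; rewrite ?filter_uniq // => e.
  by rewrite mem_filter; case HeK: (e \in K) => //=; apply: sKE.
by lia.
Qed.

Section Optimal.
Variable M : seq (V * V).
Hypotheses (M_ind : independent share E M) (M_opt : swap_optimal share E M).

Let hits g := count (conf g) M.

(** Otherwise inserting [g] alone, the candidate of the pair [g], [g], would enlarge [M]. *)
Lemma hits_gt0 g : g \in E -> 0 < hits g.
Proof.
move=> Hg; have := M_opt Hg Hg.
have confgg := conflictxx share_refl Hg.
rewrite /candidate confgg /exchange /= /unblocked.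
have -> : size [seq b <- M | ~~ has (conf b) [:: g]] = size M - hits g.
  rewrite size_filter -(count_predC (fun b => conf g b)) addKn; apply: eq_count => b /=.
  by rewrite orbF (conflict_sym E share_sym).
have : hits g <= size M by exact: count_size.
by case: posnP => // ->; rewrite subn0 ltnn.
Qed.

Let private e := [seq g <- E | conf g e && (hits g == 1)].

(** Two private edges of [e] without conflict could both be inserted at the price of deleting [e]
    only. *)
Lemma private_clique e : e \in M -> {in private e &, forall f g, conf f g}.
Proof.
move=> He f g; rewrite !mem_filter => /andP[/andP[fe /eqP Hf] fE] /andP[/andP[ge /eqP Hg] gE].
apply: contraT => /negPf nfg.
have := M_opt fE gE; rewrite /candidate nfg /exchange size_cat /=.
have [M_uniq _ _] := M_ind.
have only h : conf h e -> hits h = 1 -> forall b, b \in M -> conf h b -> b = e.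
  move=> he Hh b Hb hb; have : size [seq x <- M | conf h x] = 1 by rewrite size_filter.
  case EF: [seq x <- M | conf h x] => [|x [|]] // _.
  have mem y : y \in M -> conf h y -> y = x.
    move=> HyM Hy; have : y \in [seq x <- M | conf h x] by rewrite mem_filter Hy.
    by rewrite EF inE => /eqP.
  by rewrite (mem b) // (mem e).
have : size M <= (size (unblocked share E M [:: f; g])).+1.
  rewrite -[leqLHS](count_predC (pred1 e)) count_uniq_mem // He add1n ltnS.
  rewrite -size_filter; apply: uniq_leq_size; first exact: filter_uniq.
  move=> b; rewrite !mem_filter => /andP[/= nbe Hb]; rewrite Hb andbT /=.
  rewrite orbF negb_or; apply/andP; split; apply: contra nbe => hb.
    by rewrite (only f fe Hf b Hb) // (conflict_sym E share_sym).
  by rewrite (only g ge Hg b Hb) // (conflict_sym E share_sym).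
by move=> H1 H2; move: (leq_trans H2 H1); rewrite add2n ltnn.
Qed.

(** An edge in conflict with just one edge of [M] is private to it, so [2 <= hits g + (hits g == 1)]
    for every [g]. Double counting charges each edge of [M] with at most [2 Delta^2] conflicts and
    [11/7 Delta^2] private edges, [25/7 Delta^2] together. *)
Lemma optimal_size : 14 * size E <= 25 * (Delta * Delta) * size M.
Proof.
have [M_uniq sME M_conf] := M_ind.
have H1 : 2 * size E <= \sum_(g <- E) hits g + \sum_(g <- E) (hits g == 1).
  rewrite -big_split /= -sum1_size big_distrr /= big_seq [leqRHS]big_seq.
  by apply: leq_sum => g /hits_gt0; case: (hits g) => [|[|n]].
have H2 : \sum_(g <- E) hits g = \sum_(e <- M) count (conf e) E.
  under eq_bigr do rewrite /hits -sumn_count sumnE big_map.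
  rewrite exchange_big /=; apply: eq_bigr => e _; rewrite -sumn_count sumnE big_map.
  by apply: eq_bigr => g _; rewrite (conflict_sym E share_sym).
have H3 : \sum_(g <- E) (hits g == 1) <= \sum_(e <- M) size (private e).
  under [leqRHS]eq_bigr do rewrite size_filter -sumn_count sumnE big_map.
  rewrite exchange_big /=; apply: leq_sum => g _.
  case Hg: (hits g == 1) => //=.
  rewrite -(eqP Hg) /hits -sumn_count sumnE big_map; apply: leq_sum => e _.
  by rewrite andbT.
have H4 : 7 * \sum_(e <- M) (count (conf e) E + size (private e)) <= 25 * (Delta * Delta) * size M.
  rewrite big_distrr /= -sum1_size big_distrr /= big_seq [leqRHS]big_seq.
  apply: leq_sum => e He; rewrite muln1.
  have := count_conflict (sME _ He).
  have E_uniq : uniq E by case: HE.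
  have := clique_count (filter_uniq _ E_uniq) (mem_subseq (filter_subseq _ _)) (private_clique He).
  rewrite -/(private e); move: (size _) (count _ _) (Delta * Delta); clear; lia.
apply: leq_trans H4; rewrite big_split /= (_ : 14 = 7 * 2) // -mulnA leq_mul2l /= -H2.
exact: leq_trans H1 (leq_add (leqnn _) H3).
Qed.

End Optimal.
End EdgeList.

(** * Comparison of the conflict form with the energy *)

Section ConflictEnergy.
Local Open Scope ring_scope.
Variables (R : realFieldType) (V : finType) (G : sgraph V) (E L : seq (V * V)).
Hypotheses (HE : orientation G E) (sLE : {subset L <= E}).

Let D (u : V) : R := \sum_(a <- L) ((u == a.1)%:R + (u == a.2)%:R).

Lemma sum_ends (phi : V -> R) : \sum_(a <- L) (phi a.1 + phi a.2) = \sum_u D u * phi u.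
Proof.
have pick (v : V) : \sum_u (u == v)%:R * phi u = phi v.
  rewrite (bigD1 v) //= eqxx mul1r big1 ?addr0 // => u /negPf->.
  by rewrite mul0r.
under [RHS]eq_bigr do rewrite mulr_suml.
rewrite exchange_big /=; apply: eq_bigr => a _.
by under eq_bigr do rewrite mulrDl; rewrite big_split /= !pick.
Qed.

Lemma sum_pairs (K : rel V) :
  \sum_(a <- L) \sum_(b <- L) (((K a.1 b.1)%:R + (K a.1 b.2)%:R) + ((K a.2 b.1)%:R + (K a.2 b.2)%:R)) =
  \sum_u \sum_(v | K u v) D u * D v.
Proof.
under eq_bigr do rewrite big_split /= !(sum_ends (fun v => (K _ v)%:R)).
rewrite (sum_ends (fun u => \sum_v D v * (K u v)%:R)); apply: eq_bigr => u _.
rewrite mulr_sumr [RHS]big_mkcond; apply: eq_bigr => v _.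
by case: (K u v); rewrite ?mulr1 // !mulr0.
Qed.

Lemma sum_mult (F : V * V -> R) :
  \sum_(g <- E) list_mult R L g * F g = \sum_(a <- L) F a.
Proof.
have [E_uniq _ _] := HE.
have multE g : list_mult R L g = \sum_(a <- L) (a == g)%:R.
  by rewrite /list_mult -sumn_count sumnE big_map natr_sum.
under eq_bigr do rewrite multE mulr_suml.
rewrite exchange_big /=; apply: eq_big_seq => a /sLE Ha.
rewrite (bigD1_seq a) //= eqxx mul1r big1_seq ?addr0 // => g /andP[].
by rewrite eq_sym => /negPf-> _; rewrite mul0r.
Qed.

(** A copy of [g] in [L] is counted at both ends of [g], every other edge touching [g] at just
    one. *)
Lemma list_loadE g : g \in E -> list_load R share L g = D g.1 + D g.2 - list_mult R L g.
Proof.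
case: HE => _ _ E_asym Hg; rewrite /list_load /list_mult.
rewrite -!sumn_count !sumnE !big_map !natr_sum /D -big_split -sumrB /=.
apply: eq_big_seq => a /sLE Ha.
have ng := orientation_neq HE Hg; have na := orientation_neq HE Ha.
case: g a Hg Ha ng na => [u v] [u' v'] /= Hg Ha ng na; rewrite /share xpair_eqE /=.
rewrite [u' == u]eq_sym [v' == v]eq_sym.
case: (u =P u') => [Eu|_]; case: (u =P v') => [Ev|_]; case: (v =P u') => [Eu'|_];
  case: (v =P v') => [Ev'|_] /=; try by ring.
all: try by move: ng; rewrite ?Eu ?Ev ?Eu' ?Ev' ?eqxx.
all: try by move: na; rewrite -?Eu -?Ev -?Eu' -?Ev' ?eqxx.
all: by move: (E_asym _ _ Hg); rewrite Ev Eu' Ha.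
Qed.

(** If [a = b], this is [1 + 2 <= 2 + 1]. If they share one vertex, it is adjacent to both other
    ends, and [1 + 1 <= 2]. If they are disjoint, a conflict requires an adjacent pair of ends. *)
Lemma conflict_pair a b : a \in E -> b \in E ->
  (conflict share E a b + (((a.1 == b.1) + (a.1 == b.2)) + ((a.2 == b.1) + (a.2 == b.2))) <=
  ((G a.1 b.1 + G a.1 b.2) + (G a.2 b.1 + G a.2 b.2)) + (a == b))%N.
Proof.
case: HE => _ _ E_asym Ha Hb; rewrite (conflictP HE) //.
have Ga := orientation_adj HE Ha; have Gb := orientation_adj HE Hb.
have na := orientation_neq HE Ha; have nb := orientation_neq HE Hb.
case: a b Ha Hb Ga Gb na nb => [u v] [u' v'] /= Ha Hb Ga Gb na nb; rewrite /near xpair_eqE.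
have Ga' : G v u by rewrite adj_sym.
have Gb' : G v' u' by rewrite adj_sym.
case: (u =P u') => [Eu|_]; case: (u =P v') => [Ev|_]; case: (v =P u') => [Eu'|_];
  case: (v =P v') => [Ev'|_] /=.
all: try by move: na; rewrite ?Eu ?Ev ?Eu' ?Ev' ?eqxx.
all: try by move: nb; rewrite -?Eu -?Ev -?Eu' -?Ev' ?eqxx.
all: try by move: (E_asym _ _ Ha); rewrite Ev Eu' Hb.
all: move: Ga Ga' Gb Gb'; rewrite ?Eu ?Ev ?Eu' ?Ev' ?adj_irr => Ga Ga' Gb Gb'; rewrite ?Ga ?Ga' ?Gb ?Gb'.
all: by case: (G u u'); case: (G u v'); case: (G v u'); case: (G v v').
Qed.

(** Summing [conflict_pair] over [L] bounds the conflict form by [S - Q + I], and each of these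
    three sums can be written over the edges. For an edge with end sums [x], [y] and multiplicity
    [z], the energy exceeds twice that bound by [(x + y - z)^2 + z^2 - 4 x y + 2 z (x + y) - 2 z^2 =
    (x - y)^2]. *)
Lemma conflict_energy : 2 * (pairs_in share E L)%:R <= energy R share E L.
Proof.
pose S := \sum_u \sum_(v | G u v) D u * D v.
pose Q := \sum_u D u ^+ 2.
pose I := \sum_(a <- L) \sum_(b <- L) (a == b)%:R : R.
have H1 : (pairs_in share E L)%:R <= S - Q + I.
  rewrite /pairs_in natr_sum.
  have -> : S - Q + I = \sum_(a <- L) \sum_(b <- L)
     (((G a.1 b.1)%:R + (G a.1 b.2)%:R) + ((G a.2 b.1)%:R + (G a.2 b.2)%:R)
      - (((a.1 == b.1)%:R + (a.1 == b.2)%:R) + ((a.2 == b.1)%:R + (a.2 == b.2)%:R)) + (a == b)%:R).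
    under [RHS]eq_bigr do rewrite big_split sumrB /=.
    rewrite big_split sumrB /= sum_pairs (sum_pairs eq_op); congr (_ - _ + _).
    by apply: eq_bigr => u _; rewrite (big_pred1 u) ?expr2 // => v; apply: eq_sym.
  rewrite [leLHS]big_seq [leRHS]big_seq; apply: ler_sum => a Ha.
  rewrite -sumn_count sumnE big_map natr_sum [leLHS]big_seq [leRHS]big_seq.
  apply: ler_sum => b Hb; have := conflict_pair (sLE Ha) (sLE Hb).
  by rewrite -(ler_nat R) !natrD; lra.
have H2 : 2 * S - 2 * Q + 2 * I <= energy R share E L.
  have HS : 2 * S = \sum_(g <- E) (2 * (D g.1 * D g.2) + 2 * (D g.2 * D g.1)).
    rewrite (big_orientation HE +%R (fun u v => 2 * (D u * D v))) /S mulr_sumr.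
    by apply: eq_bigr => u _; rewrite mulr_sumr.
  have HQ : Q = \sum_(g <- E) list_mult R L g * (D g.1 + D g.2).
    rewrite sum_mult sum_ends /Q; apply: eq_bigr => u _; exact: expr2.
  have HI : I = \sum_(g <- E) list_mult R L g * list_mult R L g.
    rewrite sum_mult /I; apply: eq_bigr => a _.
    rewrite /list_mult -sumn_count sumnE big_map natr_sum.
    by apply: eq_bigr => b _; rewrite eq_sym.
  rewrite HS HQ HI !mulr_sumr -sumrB -big_split /= /energy.
  rewrite [leLHS]big_seq [leRHS]big_seq; apply: ler_sum => g Hg.
  rewrite list_loadE //; move: (D g.1) (D g.2) (list_mult R L g) => x y z.
  rewrite -subr_ge0 (_ : _ - _ = (x - y) ^+ 2); first exact: sqr_ge0.
  by ring.
by lra.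
Qed.

End ConflictEnergy.

(** * The approximation guarantee *)

Section Naturality.
Local Open Scope nat_scope.
Variables (T T' : eqType) (f : T -> T') (touch : rel T) (touch' : rel T') (x0 : T).
Hypotheses (f_inj : injective f) (f_touch : forall a b, touch' (f a) (f b) = touch a b).
Implicit Types (E L M c s : seq T) (a b e g h : T).

Lemma conflict_map E a b : conflict touch' (map f E) (f a) (f b) = conflict touch E a b.
Proof. by rewrite /conflict has_map; apply: eq_has => g /=; rewrite !f_touch. Qed.

Lemma overlap_map E a b : overlap touch' (map f E) (f a) (f b) = overlap touch E a b.
Proof.
rewrite /overlap count_map (inj_eq f_inj); congr (_ + _).
by apply: eq_count => g /=; rewrite !f_touch.
Qed.

Lemma argmin_map (w : T -> nat) (w' : T' -> nat) s : (forall a, w' (f a) = w a) ->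
  argmin (f x0) w' (map f s) = f (argmin x0 w s).
Proof.
move=> Hw; have H t a : foldl (fun a b : T' => if w' b < w' a then b else a) (f a) (map f t) =
    f (foldl (fun a b => if w b < w a then b else a) a t).
  elim: t a => //= b t IH a; rewrite !Hw -IH; by case: ifP.
by rewrite /argmin -H; case: s.
Qed.

Lemma frank_wolfe_map E k :
  frank_wolfe touch' (f x0) (map f E) k = map f (frank_wolfe touch x0 E k).
Proof.
rewrite /frank_wolfe; elim: k => //= k ->; move: (iter k _ _) => L; rewrite /fw_step.
rewrite /nilp size_map; case: ifP => //= _; congr (_ :: _).
apply: argmin_map => a; congr sumn; rewrite -map_comp.
by apply: eq_map => b /=; apply: overlap_map.
Qed.

Lemma unblocked_map E L M :
  unblocked touch' (map f E) (map f L) (map f M) = map f (unblocked touch E L M).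
Proof.
rewrite /unblocked filter_map; congr map; apply: eq_filter => b /=.
by rewrite has_map; congr (~~ _); apply: eq_has => a /=; rewrite conflict_map.
Qed.

Lemma rounding_map E L :
  rounding touch' (f x0) (map f E) (map f L) = map f (rounding touch x0 E L).
Proof.
rewrite /rounding size_map; elim: (size L) => //= k ->; rewrite /pick_step unblocked_map.
rewrite /nilp size_map; case: ifP => //= _; congr (_ :: _); apply: argmin_map => a.
by rewrite count_map; apply: eq_count => b /=; rewrite conflict_map.
Qed.

Lemma swap_map E M g h :
  swap touch' (map f E) (map f M) (f g) (f h) = map f (swap touch E M g h).
Proof.
have Hc : candidate touch' (map f E) (f g) (f h) = map f (candidate touch E g h).
  by rewrite /candidate conflict_map; case: ifP.
rewrite /swap /exchange Hc unblocked_map -map_cat !size_map.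
by case: ifP.
Qed.

Lemma local_search_map E M :
  local_search touch' (map f E) (map f M) = map f (local_search touch E M).
Proof.
rewrite /local_search size_map; elim: (size E).+1 => //= k ->.
move: (iter k _ _) => N; rewrite /swaps.
have row g t N' : foldl (fun (M : seq T') (h : T') => swap touch' (map f E) M (f g) h) (map f N') (map f t) =
    map f (foldl (fun M h => swap touch E M g h) N' t).
  by elim: t N' => //= h t IH N'; rewrite swap_map IH.
have rows t : foldl (fun (M : seq T') (g : T') =>
      foldl (fun (M : seq T') (h : T') => swap touch' (map f E) M g h) M (map f E)) (map f N) (map f t) =
    map f (foldl (fun M g => foldl (fun M h => swap touch E M g h) M E) N t).
  by elim: t N => //= g t IH N; rewrite row IH.
exact: rows.
Qed.

(** All decisions depend on [touch], on equality and on comparisons of counts, which an injective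
    relabelling preserves. This carries the analysis on ordinals over to the pairs of numbers that
    the program handles. *)
Lemma matching_of_map E :
  matching_of touch' (f x0) (map f E) = map f (matching_of touch x0 E).
Proof.
by rewrite /matching_of /sqrt_rounds size_map frank_wolfe_map rounding_map local_search_map.
Qed.

End Naturality.

Lemma matching_of_nil (T : eqType) (touch : rel T) (x0 : T) :
  matching_of touch x0 [::] = [::].
Proof.
rewrite /matching_of /rounding.
have -> : frank_wolfe touch x0 [::] (sqrt_rounds ([::] : seq T) * sqrt_rounds ([::] : seq T)) = [::].
  by rewrite /frank_wolfe; elim: (_ * _)%N => //= k ->.
by [].
Qed.

(** * Combination of the energy bound with the local search bound *)

Section Guarantee.
Local Open Scope ring_scope.
Variables (R : realFieldType) (V : finType) (G : sgraph V) (E : seq (V * V)).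
Variables (x0 : V * V) (Delta : nat) (x : V * V -> R).
Hypotheses (HE : orientation G E) (E_nonnil : E != [::]).
Hypothesis deg_le : forall u, (degree G u <= Delta)%N.
Hypotheses (x_ge0 : forall a, a \in E -> 0 <= x a)
  (load_le1 : forall g, g \in E -> load share E x g <= 1).

Lemma weight_le_load g : g \in E -> x g <= load share E x g.
Proof.
case: HE => E_uniq _ _ Hg; rewrite /load big_mkcond (bigD1_seq g) //= share_refl lerDl.
by rewrite big_seq_cond sumr_ge0 // => a /andP[/x_ge0 Ha _]; case: ifP.
Qed.

Lemma mass_le_size : mass E x <= (size E)%:R.
Proof.
rewrite /mass -sum1_size natr_sum big_seq [leRHS]big_seq; apply: ler_sum => a Ha.
exact: le_trans (weight_le_load Ha) (load_le1 Ha).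
Qed.

Lemma weighted_energy_le : weighted_energy share E x <= (size E)%:R + mass E x.
Proof.
rewrite /weighted_energy /mass -sum1_size natr_sum -big_split /=.
rewrite [leLHS]big_seq [leRHS]big_seq.
apply: ler_sum => g Hg; have x0g := x_ge0 Hg.
have H1 := load_le1 Hg; have H2 := weight_le_load Hg.
apply: lerD; first by rewrite expr_le1 // (le_trans x0g).
by rewrite expr2 ler_piMr // (le_trans H2).
Qed.

Lemma matching_guarantee : mass E x <=
  (size (matching_of share x0 E))%:R * (19 / 20 * Delta%:R + 1 / 2).
Proof.
set N := size E; set s := sqrt_rounds E.
set L := frank_wolfe share x0 E (s * s)%N.
have sLE : {subset L <= E} by apply: frank_wolfe_sub.
have iM1 : independent share E (rounding share x0 E L).
  by apply: rounding_independent => //; [apply: share_sym | apply: share_refl].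
have [iM HsM oM] := local_searchP (share_sym (V := V)) (share_refl (V := V)) iM1.
rewrite -/(matching_of share x0 E) in iM HsM oM *.
set M := matching_of share x0 E in iM HsM oM *.
have HN := optimal_size HE deg_le iM oM.
have HR := rounding_energy x0 (share_sym (V := V)) (share_refl (V := V)) sLE.
have HC := conflict_energy R HE sLE.
have E_uniq : uniq E by case: HE.
have HF := frank_wolfe_energy x0 (share_sym (V := V)) E_uniq x_ge0 (s * s) E_nonnil.
rewrite -/L in HF; rewrite (size_frank_wolfe share x0 _ E_nonnil) -/s in HR.
have s_gt0 : (0 < s)%N by rewrite /s /sqrt_rounds !muln_gt0.
have HH : harmonic R (s * s) <= 2 * s%:R.
  apply: le_trans (harmonic_le _ _ s_gt0) _.
  rewrite natrM mulfK ?pnatr_eq0 -?lt0n // mulrDl mul1r lerD2r ler_nat.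
  exact: geq_minr.
have HX := mass_le_size; have HW := weighted_energy_le.
have X0 := mass_ge0 x_ge0.
set X := mass E x in HF HX HW X0 *; set W := weighted_energy share E x in HF HW.
set en := energy R share E L in HF HC.
have S0 : 0 < s%:R :> R by rewrite ltr0n.
have sE : s%:R = 4 * (N%:R + 1) ^+ 2 :> R.
  by rewrite /s /sqrt_rounds !natrM expr2 natr1.
have N1 : 1 <= N%:R :> R.
  by rewrite ler1n lt0n size_eq0.
have m1 : (0 < size M)%N.
  case: posnP => // M0; move: HN; rewrite M0 muln0 leqn0 muln_eq0 /=.
  by rewrite size_eq0 (negPf E_nonnil).
rewrite -/N in HN HF HX HW; clearbody L M; clearbody s N.
have Hen : 2 * (s%:R * s%:R) ^+ 2 <= (size M)%:R * en.
  have H1 : ((s * s) ^ 2 <= size M * pairs_in share E L)%N.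
    by apply: leq_trans HR _; rewrite leq_mul2r HsM orbT.
  rewrite -(ler_nat R) natrX !natrM in H1.
  have H2 : (size M)%:R * (2 * (pairs_in share E L)%:R) <= (size M)%:R * en.
    by rewrite ler_wpM2l.
  by apply: le_trans H2; rewrite [leRHS]mulrCA ler_wpM2l.
(* The summand [X / 2] is the Frank-Wolfe error left after [s^2] rounds; the rest bounds the energy
   of [x]. *)
have Hkey : 2 * X ^+ 2 <= (size M)%:R * (N%:R + X + X / 2).
  have P : 0 < (s%:R * s%:R) ^+ 2 :> R by rewrite exprn_gt0 // mulr_gt0.
  rewrite -(ler_pM2r P).
  have X2 : 0 <= X ^+ 2 by apply: sqr_ge0.
  apply: (@le_trans _ _ ((size M)%:R * (X ^+ 2 * en))).
    have := ler_wpM2l X2 Hen; lra.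
  rewrite -[leRHS]mulrA ler_wpM2l //; apply: le_trans HF _.
  rewrite natrM mulrDl; apply: lerD.
    by rewrite mulrC ler_wpM2r // ltW.
  apply: (@le_trans _ _ (X ^+ 2 * (N.+1%:R * (s%:R * s%:R) * (2 * s%:R)))).
    by rewrite ler_wpM2l // ler_wpM2l // ?mulr_ge0.
  have -> : X ^+ 2 * (N.+1%:R * (s%:R * s%:R) * (2 * s%:R)) =
      (X ^+ 2 * (2 * N.+1%:R)) * s%:R ^+ 3 by ring.
  have -> : X / 2 * (s%:R * s%:R) ^+ 2 = (X / 2 * s%:R) * s%:R ^+ 3 by ring.
  rewrite ler_wpM2r ?exprn_ge0 // sE -[N.+1%:R]natr1.
  have : X * X <= X * (N%:R + 1) by rewrite ler_wpM2l //; lra.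
  have N2 : 0 <= N%:R + 1 :> R by lra.
  move=> H; have := ler_wpM2r N2 H; rewrite expr2; lra.
have HN' : 14 * N%:R <= 25 * (Delta%:R * Delta%:R) * (size M)%:R :> R.
  by rewrite -!natrM ler_nat.
have M0 : 1 <= (size M)%:R :> R by rewrite ler1n.
have D0 : 1 <= Delta%:R :> R.
  rewrite ler1n; case: (posnP Delta) => // D0; move: HN'; rewrite D0 mulr0 mulr0 mul0r; lra.
move: X ((size M)%:R) (Delta%:R) (N%:R) X0 N1 Hkey HN' M0 D0 {HX HW HF HC HH Hen}
  => {}X m D n X0 N1 Hkey HN' M0 D0.
rewrite leNgt; apply/negP => Hlt.
set t := 19 / 20 * D + 1 / 2 in Hlt.
(* The leading coefficient on the right is [2 (19/20)^2 = 1.805], above [25/14]; the linear term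
   [0.475 D] outweighs the constant [- 0.25]. *)
have T1 : 25 / 14 * (D * D) < 2 * (t * t) - 3 / 2 * t by rewrite /t; nra.
have T0 : 1 <= t by rewrite /t; lra.
(* The factors [X] and [2 X - 3/2 m] both increase with [X], so [X] may be replaced by the smaller
   [m t]; by [Hkey] the product is at most [m n]. *)
have H1 : m * t * (2 * (m * t) - 3 / 2 * m) <= X * (2 * X - 3 / 2 * m).
  have H2 : m <= m * t by rewrite ler_peMr // ltW // (lt_le_trans ltr01).
  by apply: ler_pM; nra.
have H2 : m * n <= m * (25 / 14 * (D * D) * m) by rewrite ler_wpM2l; lra.
have H3 : m * m * (25 / 14 * (D * D)) < m * m * (2 * (t * t) - 3 / 2 * t).
  by rewrite ltr_pM2l // mulr_gt0; lra.
lra.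
Qed.

End Guarantee.

(** * The arcs of the input graph *)

Section Graph.
Variables (n : nat) (G : sgraph 'I_n).

(** The reversals match the decreasing order of [indices], so that the program's list of arcs is
    exactly the image of this one. *)
Definition graph_edges : seq ('I_n * 'I_n) :=
  [seq (i, j) | i : 'I_n <- rev (enum 'I_n),
                j : 'I_n <- [seq j : 'I_n <- rev (enum 'I_n) | (i < j) && G i j]].

Definition arc_val (p : 'I_n * 'I_n) : nat * nat := (val p.1, val p.2).

Lemma arc_val_inj : injective arc_val.
Proof. by move=> [i j] [i' j'] [/val_inj-> /val_inj->]. Qed.

Lemma mem_graph_edges i j : ((i, j) \in graph_edges) = (i < j) && G i j.
Proof.
apply/allpairsPdep/idP => [[i' [j' [_]]]|Hij].
  by rewrite mem_filter => /andP[H _] [-> ->].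
by exists i, j; rewrite mem_filter !mem_rev !mem_enum Hij.
Qed.

Lemma graph_edges_orientation : orientation G graph_edges.
Proof.
split=> [|u v|u v].
- apply: allpairs_uniq_dep => [|i _|]; rewrite ?filter_uniq ?rev_uniq ?enum_uniq //.
  by move=> [i j] [i' j'] _ _ /= [-> ->].
- rewrite !mem_graph_edges [G v u]adj_sym -andb_orl -neq_ltn.
  by case: eqP => //= /val_inj->; rewrite adj_irr.
by rewrite !mem_graph_edges => /andP[H _]; rewrite ltnNge (ltnW H).
Qed.

Lemma size_rows : size (adjacency_rows G) = n.
Proof. by rewrite size_map size_enum_ord. Qed.

Lemma indices_rows : indices (adjacency_rows G) = map val (rev (enum 'I_n)).
Proof.
rewrite map_rev val_enum_ord /indices size_rows.
suff H k : k <= n -> iter k (fun s => if size s < n then size s :: s else s) [::] = rev (iota 0 k).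
  exact: H.
elim: k => // k IH Hk; rewrite iterS IH ?(ltnW Hk) // size_rev size_iota Hk.
by rewrite -[in RHS]addn1 iotaD add0n cats1 rev_rcons.
Qed.

Lemma edge_arcs_rows : edge_arcs (adjacency_rows G) = map arc_val graph_edges.
Proof.
rewrite /edge_arcs indices_rows /graph_edges map_flatten -!map_comp.
congr flatten; apply: eq_map => i /=; rewrite filter_map -!map_comp.
have -> : [seq j : 'I_n <- rev (enum 'I_n) | (i < j) && G i j] =
  [seq j : 'I_n <- rev (enum 'I_n) |
    preim val (fun j => (i < j) && nth false (nth [::] (adjacency_rows G) i) j) j].
  apply: eq_filter => j /=; congr (_ && _).
  rewrite (nth_map i) ?size_enum_ord // nth_ord_enum.
  by rewrite (nth_map i) ?size_enum_ord // nth_ord_enum.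
by [].
Qed.

Lemma share_arc_val a b : share (arc_val a) (arc_val b) = share a b.
Proof. by []. Qed.

End Graph.

(** For [n = 0] there is no pair of vertices to serve as default value, hence the separate case;
    otherwise [(ord0, ord0)] is mapped to the program's default [(0, 0)]. *)
Lemma matching_of_graph n (G : sgraph 'I_n) :
  exists2 s : seq ('I_n * 'I_n),
    map (@arc_val n) s = matching_of share (0, 0)%N (edge_arcs (adjacency_rows G)) &
    (graph_edges G = [::] /\ s = [::]) \/ exists x0, s = matching_of share x0 (graph_edges G).
Proof.
case: n G => [|m] G; rewrite edge_arcs_rows.
  have E0 : graph_edges G = [::] by case: (graph_edges G) => // -[[]].
  by exists [::]; [rewrite E0 matching_of_nil | left].
exists (matching_of share (ord0, ord0) (graph_edges G)); last by right; eexists.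
by rewrite -(matching_of_map (ord0, ord0) (@arc_val_inj m.+1) (@share_arc_val m.+1)).
Qed.

(** * The linear program in terms of arcs *)

Section LinearProgram.
Local Open Scope ring_scope.
Variables (R : realType) (V : finType) (G : sgraph V) (E : seq (V * V)).
Hypothesis HE : orientation G E.

Definition arc_set (a : V * V) : {set V} := [set a.1; a.2].

Lemma arc_set_inj : {in E &, injective arc_set}.
Proof.
case: HE => E_uniq E_adj E_asym [u v] [u' v'] Ha Hb /setP H.
have := orientation_neq HE Ha; rewrite /= => nuv.
have := H u; have := H v; rewrite !inE !eqxx ?orbT /= => /esym/orP Hv /esym/orP Hu.
case: Hu Hv => /eqP Eu [] /eqP Ev; subst; rewrite ?eqxx // in nuv *.
by move: (E_asym _ _ Ha); rewrite Hb.
Qed.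

Lemma edgesE : edges G = [set arc_set a | a in E].
Proof.
case: HE => _ E_adj _; apply/setP => e; apply/imset2P/imsetP => [[u v _ Huv ->]|[[u v] Ha ->]].
  move: Huv; rewrite !inE E_adj => /orP[] H; first by exists (u, v).
  by exists (v, u); rewrite // /arc_set /= setUC.
by exists u v; rewrite ?inE // E_adj Ha.
Qed.

Lemma share_arc_set a b : share a b = ~~ [disjoint arc_set a & arc_set b].
Proof.
rewrite /share -setI_eq0; apply/idP/set0Pn => [|[w]].
  by case/or4P=> /eqP H; [exists a.1|exists a.1|exists a.2|exists a.2];
    rewrite !inE H eqxx ?orbT.
by rewrite !inE => /andP[/orP[] /eqP-> /orP[] /eqP->]; rewrite eqxx ?orbT.
Qed.

Lemma edge_deltaE a : a \in E ->
  edge_delta G (arc_set a) = [set arc_set b | b in [pred b in E | share a b]].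
Proof.
move=> Ha; apply/setP => f; apply/bigcupP/imsetP => [[w Hw]|[b /andP[Hb]]].
  rewrite inE edgesE => /andP[/imsetP[b Hb ->] Hwb]; exists b => //.
  rewrite !inE Hb share_arc_set /= -setI_eq0; apply/set0Pn; exists w.
  by rewrite inE Hw.
rewrite share_arc_set -setI_eq0 => /set0Pn[w]; rewrite inE => /andP[Hwa Hwb] ->.
by exists w => //; rewrite inE Hwb edgesE andbT; apply/imsetP; exists b.
Qed.

Variable x : {set V} -> R.
Hypothesis Hx : lp_feasible G x.

Lemma sum_edges : \sum_(e in edges G) x e = mass E (x \o arc_set).
Proof.
have E_uniq : uniq E by case: HE.
by rewrite edgesE big_imset /= -?big_uniq //; apply: arc_set_inj.
Qed.

Lemma load_arc_set a : a \in E ->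
  load share E (x \o arc_set) a = \sum_(f in edge_delta G (arc_set a)) x f.
Proof.
move=> Ha; have E_uniq : uniq E by case: HE.
rewrite edge_deltaE // big_imset /=; last first.
  by move=> b c; rewrite !inE => /andP[Hb _] /andP[Hc _]; apply: arc_set_inj.
rewrite /load big_mkcond big_uniq //= [LHS]big_mkcond [RHS]big_mkcond /=.
by apply: eq_bigr => b _; rewrite !inE; case: (b \in E).
Qed.

Lemma lp_arc_ge0 a : a \in E -> 0 <= (x \o arc_set) a.
Proof. by case: Hx => _ H Ha; apply: H; rewrite edgesE imset_f. Qed.

Lemma lp_load_le1 a : a \in E -> load share E (x \o arc_set) a <= 1.
Proof. by case: Hx => H _ Ha; rewrite load_arc_set // H // edgesE imset_f. Qed.

End LinearProgram.

Section Output.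
Variables (V : finType) (G : sgraph V) (E M : seq (V * V)).
Hypotheses (HE : orientation G E) (iM : independent share E M).

Let S : {set {set V}} := [set arc_set p | p in M].

Lemma card_output : #|S| = size M.
Proof.
have [M_uniq sME _] := iM.
rewrite card_in_imset ?(card_uniqP M_uniq) // => a b /sME Ha /sME Hb.
exact: arc_set_inj HE _ _ Ha Hb.
Qed.

Lemma output_induced : induced_matching G S.
Proof.
have [M_uniq sME M_conf] := iM; split.
  by apply/subsetP => f /imsetP[a /sME Ha ->]; rewrite (edgesE HE) imset_f.
move=> _ _ /imsetP[a Ha ->] /imsetP[b Hb ->] nab.
have {}nab : a != b by apply: contraNneq nab => ->.
have := M_conf _ _ Ha Hb nab; rewrite (conflictP HE) ?sME //.
move=> /norP[H1 /norP[H2 /norP[H3 H4]]].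
have far u v : u \in arc_set a -> v \in arc_set b -> ~~ near G u v.
  by rewrite !inE => /orP[] /eqP-> /orP[] /eqP->.
split.
  rewrite -setI_eq0; apply/eqP/setP => w; rewrite in_set0 inE; apply/negP => /andP[Hwa Hwb].
  by move: (far _ _ Hwa Hwb); rewrite /near eqxx.
by move=> u v Hu Hv; move: (far _ _ Hu Hv); rewrite /near negb_or => /andP[].
Qed.

End Output.

(** * An upper bound on the optimal [epsilon] *)

Section Epsilon.
Local Open Scope ring_scope.
Variable R : realType.

Lemma eps_feasible_le (e c : R) : eps_feasible e c -> e <= 1 / 20.
Proof.
case=> H1 H2 H3 e0 c0.
have d0 : 0 < 1 - c - e by lra.
have c34 : 3 / 4 <= c.
  (* Numerator and denominator add up to [c > 0]. With this bound the first constraint becomes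
     [3/2 (1 - e) <= 2 c (1 - e)]. *)
  have Hq : - 1 <= (2 * c - 1 + e) / (1 - c - e) by rewrite ler_pdivlMr //; lra.
  have He : - e <= e * (2 * c - 1 + e) / (1 - c - e).
    by rewrite -mulrA -[leLHS]mulr1 -[leLHS]mulrNN mulrN1 opprK; nra.
  have H4 : 3 / 2 * (1 - e) <= 2 * c * (1 - e) by lra.
  have e1 : 0 < 1 - e by lra.
  by rewrite ler_pM2r // in H4; lra.
have He : 0 <= e * (2 * c - 1 + e) / (1 - c - e).
  by rewrite divr_ge0 ?(ltW d0) // mulr_ge0 ?(ltW e0) //; lra.
have H4 : 3 / 2 <= 2 * c * (1 - e) by lra.
rewrite leNgt; apply/negP => He20.
(* Here [(11/50)^2 < 1/20 < e <= (1 - c)^2]. Then [c < 39/50], and [2 c (1 - e)] stays below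
   [2 (39/50) (19/20) = 1.482], against [H4]. *)
have Hc : 11 / 50 < 1 - c by nra.
nra.
Qed.

Lemma eps_opt_le : eps_opt R <= 1 / 20.
Proof.
rewrite /eps_opt; set A := (X in sup X).
have [[e He]|A0] := boolp.pselect (classical_sets.nonempty A).
  apply: ge_sup; first by exists e.
  by move=> e' [c] /eps_feasible_le.
(* The supremum of an empty set is 0 by convention. *)
by rewrite sup_out ?divr_ge0 //; case.
Qed.

End Epsilon.

Lemma tree_of_pairsE n (s : seq ('I_n * 'I_n)) :
  tree_of_pairs s = tree_of_seq tree_of_arc (map (@arc_val n) s).
Proof. by rewrite /tree_of_pairs; elim: s => //= a s ->. Qed.

Local Open Scope ring_scope.

Theorem theorem3 (R : realType) :
  exists (p : com) (q : {poly nat}),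
    forall (Delta n : nat) (G : sgraph 'I_n),
      (3 <= Delta)%N -> (max_degree G <= Delta)%N ->
      exists (s : seq ('I_n * 'I_n)) (t : nat),
        [/\ computes p (tree_of_instance Delta G) (tree_of_pairs s) t,
            (t <= q.[tree_size (tree_of_instance Delta G)])%N,
            induced_matching G (set_of_pairs s)
          & fractional_induced_matching_number G R
              / ((1 - eps_opt R) * Delta%:R + 1 / 2)
            <= #|set_of_pairs s|%:R].
Proof.
have [p [q Hpq]] := matching_of_ptime.
exists p, q => Delta n G D3 HD.
have [t [Ht Htq]] := Hpq (Instance Delta G).
have [s Hs Hcase] := matching_of_graph G.
have deg_le u : (degree G u <= Delta)%N.
  by apply: leq_trans HD; apply: leq_bigmax.
have HE := graph_edges_orientation G.
have iM : independent share (graph_edges G) s.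
  case: Hcase => [[_ ->]|[x0 ->]]; first by split.
  have E0 : graph_edges G != [::] \/ graph_edges G = [::] by case: eqP; [right|left].
  case: E0 => [E0|->]; last by rewrite matching_of_nil.
  have sLE k : {subset frank_wolfe share x0 (graph_edges G) k <= graph_edges G}.
    exact: frank_wolfe_sub.
  have iM := rounding_independent x0 (@share_sym 'I_n) (@share_refl 'I_n) (sLE _).
  rewrite /matching_of; set k := (_ * _)%N.
  by have [] := local_searchP (@share_sym 'I_n) (@share_refl 'I_n) (iM k).
exists s, t; split=> //.
- by rewrite tree_of_pairsE Hs.
- exact: output_induced HE iM.
rewrite (card_output HE iM).
have D0 : 3 <= Delta%:R :> R by rewrite ler_nat.
have He := eps_opt_le R.
(* A smaller [eps_opt] only enlarges the denominator, so an upper bound on it suffices. *)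
have den : 19 / 20 * Delta%:R + 1 / 2 <= (1 - eps_opt R) * Delta%:R + 1 / 2.
  by rewrite lerD2r ler_wpM2r //; lra.
rewrite ler_pdivrMr; last by apply: lt_le_trans den; lra.
apply: (@le_trans _ _ ((size s)%:R * (19 / 20 * Delta%:R + 1 / 2))); last by rewrite ler_wpM2l.
apply: ge_sup.
  (* The zero weighting is feasible, so the supremum is taken over a nonempty set. *)
  exists 0, (fun=> 0); last by rewrite big1.
  by split=> e He'; rewrite ?big1 ?ler01.
move=> _ [x Hx <-]; rewrite (sum_edges HE).
case: Hcase => [[E0 ->]|[x0 Es]].
  by rewrite /mass E0 big_nil mul0r.
have [E0|E0] := eqVneq (graph_edges G) [::].
  by rewrite /mass E0 big_nil mulr_ge0 //; lra.
rewrite Es; apply: (matching_guarantee x0 HE E0 deg_le).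
- by move=> a; apply: (lp_arc_ge0 HE Hx).
- by move=> g; apply: (lp_load_le1 HE Hx).
Qed.
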